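(* Let $\mu<0$, $k=e^{-\mu}$, $g_c=k/(1+k)^2$, $X(g)=\frac{1-\sqrt{1-4g}}2$. The sequence $(\nu_N^{(\mu)})_{N\in\mathbb N}$ converges weakly to a Borel probability measure $\nu^{(\mu)}$ on $\mathcal T$, characterized by $$\nu^{(\mu)}\big(\mathcal B_{1/r}(T_0)\big)=K\,k^{r-1}g_c^{|T_0|-K}X(g_c)^{K-1}$$ for every $T_0\in\mathcal T_{\rm fin}$ of height $r\ge1$, where $K=|D_r(T_0)|$.
   Context: Rooted planar trees with root of degree 1; $D_r(T)$ = vertices at height $r$; $|T|$ = number of edges; $h(T)$ = height; $\mathcal T$ = set of all finite and infinite (locally finite) such trees with metric $\mathrm{dist}(T,T')=\inf\{1/r: B_r(T)=B_r(T')\}$, $B_r(T)$ being the subtree spanned by vertices of height $\le r$; $\mathcal B_{1/r}(T_0)=\{T: B_r(T)=T_0\}$ for $T_0$ of height $r$. $Z_N^{(\mu)}=\sum_{|T|=N}e^{-\mu h(T)}$ and $\nu_N^{(\mu)}(T)=e^{-\mu h(T)}/Z_N^{(\mu)}$ for $|T|=N$, viewed as a Borel measure on $\mathcal T$. *)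

(* Defs.v *)
From HB Require Import structures.
From mathcomp Require Import all_boot all_order all_algebra.
From mathcomp Require Import all_classical all_reals all_analysis.
From mathcomp Require Import finmap.

Set Implicit Arguments.
Unset Strict Implicit.
Unset Printing Implicit Defensive.

Import Order.TTheory GRing.Theory Num.Theory.
Local Open Scope classical_set_scope.
Local Open Scope ring_scope.

(* A rooted planar (plane) tree is encoded by its set of vertices, each vertex
   being its address (Ulam-Harris / Neveu encoding): the root is [::], and the
   children of a vertex v are rcons v 0, rcons v 1, ..., numbered from left to
   right (planarity).  The height of vertex v is size v. *)
Definition is_tree (V : set (seq nat)) : Prop :=
  [/\ V [::],
      V [:: 0%N] /\ ~ V [:: 1%N],
      (forall v i, V (rcons v i) -> V v),
      (forall v (i : nat), V (rcons v i.+1) -> V (rcons v i)) &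
      (* locally finite: every vertex has finitely many children *)
      (forall v, exists n : nat, ~ V (rcons v n))].

Record tree := Tree { tverts : set (seq nat); tree_ax : is_tree tverts }.

HB.instance Definition _ := gen_eqMixin tree.
HB.instance Definition _ := gen_choiceMixin tree.

Definition tree1_verts : set (seq nat) := [set v | v = [::] \/ v = [:: 0%N]].

Lemma tree1_ax : is_tree tree1_verts.
Proof.
rewrite /tree1_verts; split => /=.
- exact: (or_introl erefl).
- split; first exact: (or_intror erefl).
  by case.
- move=> v i [] H.
  + by move/(congr1 size): H; rewrite size_rcons.
  + left; case: v H => [|a l] //= [] _ /(congr1 size).
    by rewrite size_rcons.
- move=> v i [] H.
  + by move/(congr1 size): H; rewrite size_rcons.
  + case: v H => [|a l] //= [] _ /(congr1 size).
    by rewrite size_rcons.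
- move=> v; exists 1%N => [] [] H.
  + by move/(congr1 size): H; rewrite size_rcons.
  + case: v H => [|a l] //= [] _ /(congr1 size).
    by rewrite size_rcons.
Qed.

Definition tree1 : tree := Tree tree1_ax.

HB.instance Definition _ := isPointed.Build tree tree1.

Definition tfin (T : tree) : Prop := finite_set (tverts T).

(* |T| = number of edges = number of vertices - 1 (meaningful for finite T) *)
Definition nedges (T : tree) : nat := (#|` fset_set (tverts T)|).-1.

(* h(T) = maximal height of a vertex (meaningful for finite T) *)
Definition height (T : tree) : nat :=
  \big[maxn/0%N]_(v <- enum_fset (fset_set (tverts T))) size v.

Definition Dr (r : nat) (T : tree) : set (seq nat) :=
  [set v | tverts T v /\ size v = r].
Definition card_Dr (r : nat) (T : tree) : nat := #|` fset_set (Dr r T)|.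

Definition trunc (r : nat) (T : tree) : set (seq nat) :=
  [set v | tverts T v /\ (size v <= r)%N].

Definition tdist (R : realType) (T T' : tree) : R :=
  inf [set (r%:R)^-1 | r in [set r : nat | (0 < r)%N /\ trunc r T = trunc r T']].

Definition tball (r : nat) (T0 : tree) : set tree :=
  [set T | trunc r T = tverts T0].

Definition topen (R : realType) (A : set tree) : Prop :=
  forall T, A T -> exists2 e : R, 0 < e & forall T', tdist R T T' < e -> A T'.

Definition treeB (R : realType) := g_sigma_algebraType (@topen R).

Definition tcontinuous (R : realType) (f : tree -> R) : Prop :=
  forall T (e : R), 0 < e ->
    exists2 d : R, 0 < d & forall T', tdist R T T' < d -> `|f T - f T'| < e.

Definition tbounded (R : realType) (f : tree -> R) : Prop :=
  exists M : R, forall T, `|f T| <= M.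

Definition treesN (N : nat) : set tree := [set T | tfin T /\ nedges T = N].

Definition ZN (R : realType) (mu : R) (N : nat) : R :=
  \sum_(T \in treesN N) expR (- mu * (height T)%:R).

(* nu_N^{(mu)}(T) for |T| = N *)
Definition nuN (R : realType) (mu : R) (N : nat) (T : tree) : R :=
  expR (- mu * (height T)%:R) / ZN mu N.

(* integral of f against the (finitely supported) probability nu_N^{(mu)} *)
Definition EnuN (R : realType) (mu : R) (N : nat) (f : tree -> R) : R :=
  \sum_(T \in treesN N) f T * nuN mu N T.

(* Main.v *)
Require Import Defs.
From HB Require Import structures.
From mathcomp Require Import all_boot all_order all_algebra.
From mathcomp Require Import all_classical all_reals all_analysis.
From mathcomp Require Import measurable_realfun finmap zify ring lra.

(** Let X_m be the generating function of the trees of height at most m and X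
    that of all trees: X_0 = 0, X_{m+1} = g + X_m X_{m+1} and X = g + X^2.  A tree
    T with truncation T0 at height r is obtained by planting a tree at each of
    the K top vertices of T0; hence, up to the factor k^(r-1) g^(|T0|-K), the
    generating function of the weights k^h(T) of these trees is
    X^K + (k-1) sum_m k^m (X^K - X_m^K).  For U_m = X - X_m, the recursion
    (1 - X) U_{m+1} = X U_m - U_m U_{m+1} yields
    (1 - (1+k) X) sum_m k^m U_m = g - k sum_m k^m U_m U_{m+1}, and
    (1 - (1+k) X) (1 - (1+k) (1-X)) = - k (1 - g/g_c).  At g_c one has
    X = 1/(1+k) and U_m = O(k^-m), so that the right-hand side converges there:
    the N-th coefficient of sum_m k^m U_m is asymptotic to sigma g_c^-N with
    sigma > 0, and that of sum_m k^m (X^K - X_m^K) to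
    K X(g_c)^(K-1) sigma g_c^-N.  The quotient gives the limit of the
    probability of each ball.

    These limits form a consistent family of masses, as the identity
    sum_n (Y + t)^n = 1/(1 - Y - t), read at order 1 in t, shows; they are the
    masses of the balls for the law of a random tree read off a uniform point
    of [0, 1[ by means of nested intervals.  No mass being lost in the limit,
    the convergence on balls implies weak convergence, because a continuous
    function has small oscillation on finitely many balls of equal radius which
    carry almost all the mass. *)

Set Implicit Arguments.
Unset Strict Implicit.
Unset Printing Implicit Defensive.

Import Order.TTheory GRing.Theory Num.Theory.
Import numFieldNormedType.Exports.
Local Open Scope classical_set_scope.
Local Open Scope ring_scope.

(** * Formal power series *)

(** No singularity analysis is involved: nonnegative coefficients replace it. The weights [gc ^+ n]
    are absorbed into the coefficients, so that the critical point becomes t = 1. Once the pole is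
    isolated as a factor 1 - t, dividing by it amounts to taking partial sums, and the coefficients
    converge because a series converges at 1. Every exchange of sums is then an instance of monotone
    convergence, and identities between infinite sums are checked one coefficient at a time on
    finite sums. For uniqueness, the difficulty is that the formula prescribes only the balls around
    trees of height exactly r, and these do not cover the space at level r. *)

Record fps (R : nzRingType) := Fps { fcoef :> nat -> R }.

HB.instance Definition _ (R : nzRingType) := gen_eqMixin (fps R).
HB.instance Definition _ (R : nzRingType) := gen_choiceMixin (fps R).

Section FpsRing.
Variable R : comNzRingType.
Implicit Types a b c : fps R.

Lemma fpsP a b : (forall n, a n = b n) -> a = b.
Proof. by case: a b => a [b] /= ab; congr Fps; apply: funext. Qed.

Definition fps_add a b : fps R := Fps (fun n => a n + b n).
Definition fps_opp a : fps R := Fps (fun n => - a n).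
Definition fps_mul a b : fps R := Fps (fun n => \sum_(i < n.+1) a i * b (n - i)%N).
(** Commutativity and associativity of the Cauchy product are inherited from polynomials: up to
    degree N, the coefficients of a product are those of the product of the truncations. *)
Definition fps_poly N a : {poly R} := \poly_(i < N.+1) a i.

Lemma coef_fps_poly N a n : (n <= N)%N -> (fps_poly N a)`_n = a n.
Proof. by move=> nN; rewrite coef_poly ltnS nN. Qed.

Lemma coef_fps_polyM N a b n : (n <= N)%N ->
  (fps_poly N a * fps_poly N b)`_n = fps_mul a b n.
Proof.
move=> nN; rewrite coefM; apply: eq_bigr => i _.
by rewrite !coef_fps_poly //; case: i => i /=; lia.
Qed.

Lemma fps_addA : associative fps_add.
Proof. by move=> a b c; apply: fpsP => n /=; rewrite addrA. Qed.
Lemma fps_addC : commutative fps_add.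
Proof. by move=> a b; apply: fpsP => n /=; rewrite addrC. Qed.
Lemma fps_add0 : left_id (Fps (fun=> 0)) fps_add.
Proof. by move=> a; apply: fpsP => n /=; rewrite add0r. Qed.
Lemma fps_addN : left_inverse (Fps (fun=> 0)) fps_opp fps_add.
Proof. by move=> a; apply: fpsP => n /=; rewrite addNr. Qed.

HB.instance Definition _ := GRing.isZmodule.Build (fps R)
  fps_addA fps_addC fps_add0 fps_addN.

Lemma fps_mulC : commutative fps_mul.
Proof.
by move=> a b; apply: fpsP => n; rewrite -!(@coef_fps_polyM n) // mulrC.
Qed.
Lemma fps_mulA : associative fps_mul.
Proof.
move=> a b c; apply: fpsP => n.
transitivity ((fps_poly n a * (fps_poly n b * fps_poly n c))`_n).
  rewrite coefM; apply: eq_bigr => i _; rewrite coef_fps_polyM ?leq_subr//.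
  by rewrite coef_fps_poly// -ltnS.
rewrite mulrA coefM; apply: eq_bigr => i _.
rewrite coef_fps_polyM ?coef_fps_poly ?leq_subr//.
by rewrite -ltnS.
Qed.
Lemma fps_mul1 : left_id (Fps (fun n => (n == 0%N)%:R)) fps_mul.
Proof.
move=> a; apply: fpsP => n /=; rewrite big_ord_recl big1 /= ?addr0 ?mul1r ?subn0//.
by move=> i _; rewrite mul0r.
Qed.
Lemma fps_mulDl : left_distributive fps_mul fps_add.
Proof.
move=> a b c; apply: fpsP => n /=; rewrite -big_split/=.
by apply: eq_bigr => i _; rewrite mulrDl.
Qed.
Lemma fps_one_neq0 : Fps (fun n => (n == 0%N)%:R) != (0 : fps R).
Proof.
by apply/eqP => /(congr1 (fun a : fps R => a 0%N))/= /eqP; rewrite oner_eq0.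
Qed.

(** The record [fps] keeps this product apart from the pointwise product of functions. *)
HB.instance Definition _ := GRing.Zmodule_isComNzRing.Build (fps R)
  fps_mulA fps_mulC fps_mul1 fps_mulDl fps_one_neq0.

Definition fpsC (x : R) : fps R := Fps (fun n => if n == 0%N then x else 0).
Definition fpsX : fps R := Fps (fun n => (n == 1%N)%:R).

Lemma fps1E n : (1 : fps R) n = (n == 0%N)%:R. Proof. by []. Qed.
Lemma fpsDE a b n : (a + b) n = a n + b n. Proof. by []. Qed.
Lemma fpsNE a n : (- a) n = - a n. Proof. by []. Qed.
Lemma fpsBE a b n : (a - b) n = a n - b n. Proof. by []. Qed.
Lemma fpsME a b n : (a * b) n = \sum_(i < n.+1) a i * b (n - i)%N.
Proof. by []. Qed.
Lemma fps_sumE (I : Type) (s : seq I) (P : pred I) (F : I -> fps R) n :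
  (\sum_(i <- s | P i) F i) n = \sum_(i <- s | P i) F i n.
Proof. by elim/big_rec2 : _ => // i x y _ <-. Qed.

Lemma fpsCME x a n : (fpsC x * a) n = x * a n.
Proof.
rewrite fpsME big_ord_recl/= subn0 big1 ?addr0// => i _.
by rewrite mul0r.
Qed.
Lemma fpsXME a n : (fpsX * a) n = if n is m.+1 then a m else 0.
Proof.
rewrite fpsME; case: n => [|n].
  by rewrite big_ord_recl big_ord0/= mul0r addr0.
rewrite !big_ord_recl/= mul0r add0r mul1r big1 ?addr0 ?subSS ?subn0//.
by move=> i _; rewrite mul0r.
Qed.
Lemma fpsXnME d a n : (fpsX ^+ d * a) n = if (d <= n)%N then a (n - d)%N else 0.
Proof.
elim: d n => [|d IH] n; first by rewrite expr0 mul1r subn0.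
by rewrite exprS -mulrA fpsXME; case: n.
Qed.
Lemma fpsCD x y : fpsC (x + y) = fpsC x + fpsC y.
Proof. by apply: fpsP => -[|n]; rewrite fpsDE/= ?addr0. Qed.
Lemma fpsCM x y : fpsC (x * y) = fpsC x * fpsC y.
Proof. by apply: fpsP => -[|n]; rewrite fpsCME/= ?mulr0. Qed.
Lemma fpsC1 : fpsC 1 = 1.
Proof. by apply: fpsP => -[|n]. Qed.
Lemma fpsCn n : fpsC n%:R = n%:R.
Proof.
elim: n => [|n IH]; last by rewrite -addn1 !natrD fpsCD IH fpsC1.
by apply: fpsP => -[|n].
Qed.
Lemma fpsCX x n : fpsC (x ^+ n) = fpsC x ^+ n.
Proof. by elim: n => [|n IH]; rewrite ?expr0 ?fpsC1// !exprS fpsCM IH. Qed.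

(** Congruence modulo t^(N+1), which lets an infinite sum be replaced by a finite one when a fixed
    coefficient is computed. *)
Definition eqfps N a b := forall n, (n <= N)%N -> a n = b n.

Lemma eqfps_refl N a : eqfps N a a. Proof. by []. Qed.
Lemma eqfpsD N a b c d : eqfps N a b -> eqfps N c d -> eqfps N (a + c) (b + d).
Proof. by move=> ab cd n nN; rewrite !fpsDE ab// cd. Qed.
Lemma eqfpsN N a b : eqfps N a b -> eqfps N (- a) (- b).
Proof. by move=> ab n nN; rewrite !fpsNE ab. Qed.
Lemma eqfpsM N a b c d : eqfps N a b -> eqfps N c d -> eqfps N (a * c) (b * d).
Proof.
move=> ab cd n nN; rewrite !fpsME; apply: eq_bigr => -[i i_n] _ /=.
by rewrite ab ?cd//; lia.
Qed.
Lemma eqfpsX N a b k : eqfps N a b -> eqfps N (a ^+ k) (b ^+ k).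
Proof.
by move=> ab; elim: k => [|k IH]; rewrite ?expr0// !exprS; apply: eqfpsM.
Qed.

Lemma fpsX_low a k n : a 0%N = 0 -> (n < k)%N -> (a ^+ k) n = 0.
Proof.
move=> a0; elim: k n => [//|k IH] n nk; rewrite exprS fpsME.
rewrite big1// => -[[|i] /= i_n] _; first by rewrite a0 mul0r.
by rewrite IH ?mulr0//; lia.
Qed.

End FpsRing.

(** * Values at 1 of series with nonnegative coefficients *)

Lemma ler_cvgn (R : realType) (u v : nat -> R) (l l' : R) :
  u @ \oo --> l -> v @ \oo --> l' -> (forall n, u n <= v n) -> l <= l'.
Proof. by move=> ul vl uv; apply: ler_cvg_to ul vl _; apply: nearW. Qed.

Section FpsSums.
Variable R : realType.
Implicit Types (a b : fps R) (s t : R).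

Definition nneg_fps a := forall n, 0 <= a n.

Lemma nneg_fpsD a b : nneg_fps a -> nneg_fps b -> nneg_fps (a + b).
Proof. by move=> a0 b0 n; rewrite fpsDE addr_ge0. Qed.
Lemma nneg_fpsM a b : nneg_fps a -> nneg_fps b -> nneg_fps (a * b).
Proof. by move=> a0 b0 n; rewrite fpsME sumr_ge0// => i _; rewrite mulr_ge0. Qed.
Lemma nneg_fps1 : nneg_fps 1.
Proof. by move=> n; rewrite fps1E ler0n. Qed.
Lemma nneg_fpsexp a k : nneg_fps a -> nneg_fps (a ^+ k).
Proof.
move=> a0; elim: k => [|k IH]; rewrite ?expr0 ?exprS; first exact: nneg_fps1.
exact: nneg_fpsM.
Qed.
Lemma nneg_fpsC x : 0 <= x -> nneg_fps (fpsC x).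
Proof. by move=> x0 [|n]. Qed.
Lemma nneg_fpsX : nneg_fps (fpsX R).
Proof. by move=> n; rewrite /= ler0n. Qed.
Lemma nneg_fps_sum (I : Type) (r : seq I) (P : pred I) (F : I -> fps R) :
  (forall i, P i -> nneg_fps (F i)) -> nneg_fps (\sum_(i <- r | P i) F i).
Proof. by move=> F0 n; rewrite fps_sumE sumr_ge0// => i /F0. Qed.

(** Evaluation at t = 1; for the tree series, whose coefficients carry [gc ^+ n], this is evaluation
    at the critical point. *)
Definition hsum a s := series a @ \oo --> s.

Lemma hsum_unique a s t : hsum a s -> hsum a t -> s = t.
Proof. exact: cvg_unique. Qed.
Lemma hsumD a b s t : hsum a s -> hsum b t -> hsum (a + b) (s + t).
Proof.
rewrite /hsum => sa sb; have -> : series (a + b) = series a \+ series b.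
  by apply: funext => n; rewrite /series/= -big_split.
exact: cvgD.
Qed.
Lemma hsumN a s : hsum a s -> hsum (- a) (- s).
Proof.
rewrite /hsum => sa; have -> : series (- a) = \- series a.
  by apply: funext => n; rewrite /series/= -sumrN.
exact: cvgN.
Qed.
Lemma hsumB a b s t : hsum a s -> hsum b t -> hsum (a - b) (s - t).
Proof. by move=> ? ?; apply: hsumD => //; apply: hsumN. Qed.

Lemma hsum_le a s n : nneg_fps a -> hsum a s -> series a n <= s.
Proof.
move=> a0 sa; rewrite -(cvg_lim (@Rhausdorff R) sa).
apply: nondecreasing_cvgn_le; last by apply/cvg_ex; exists s.
by apply: nondecreasing_series => i _ _.
Qed.
Lemma hsum_ge0 a s : nneg_fps a -> hsum a s -> 0 <= s.
Proof. by move=> a0 /(hsum_le 0%N a0); rewrite /series/= big_geq. Qed.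

Lemma hsum_bounded a s : nneg_fps a -> (forall n, series a n <= s) ->
  exists2 t, hsum a t & t <= s.
Proof.
move=> a0 sa; have ca : cvgn (series a).
  apply: nondecreasing_is_cvgn; first by apply: nondecreasing_series => i _ _.
  by exists s => _ [n _ <-].
exists (limn (series a)) => //; apply: limr_le => //.
by apply: nearW.
Qed.

Lemma hsum0 a s : hsum a s -> a n @[n --> \oo] --> (0 : R).
Proof. by move=> sa; apply: cvg_series_cvg_0; apply/cvg_ex; exists s. Qed.

Lemma hsum_fin a N : (forall n, (N <= n)%N -> a n = 0) ->
  hsum a (\sum_(0 <= i < N) a i).
Proof.
move=> aN; apply: cvg_near_cst; near=> n.
have Nn : (N <= n)%N by near: n; exact: nbhs_infty_ge.
rewrite /series/= (big_cat_nat (n := N))//= [X in _ + X]big_nat_cond [X in _ + X]big1 ?addr0//.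
by move=> i /andP[/andP[Ni _] _]; rewrite aN.
Unshelve. all: by end_near. Qed.

Lemma hsumC x : hsum (fpsC x) x.
Proof.
have := @hsum_fin (fpsC x) 1; rewrite big_nat1; apply.
by case.
Qed.
Lemma hsum1 : hsum 1 1.
Proof. by rewrite -fpsC1; apply: hsumC. Qed.
Lemma hsumX : hsum (fpsX R) 1.
Proof.
have := @hsum_fin (fpsX R) 2; rewrite !big_nat_recr ?big_geq//= !add0r; apply.
by case=> [|[]].
Qed.

Lemma series_fpsM a b n :
  series (a * b) n = \sum_(0 <= i < n) a i * series b (n - i)%N.
Proof.
elim: n => [|n IH]; first by rewrite /series/= !big_geq.
rewrite seriesSr IH fpsME big_ord_recr/= subnn.
rewrite [RHS]big_nat_recr//= subSnn {3}/series/= big_nat1.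
rewrite addrA; congr (_ + _); rewrite -(big_mkord predT (fun i => a i * b (n - i)%N)).
rewrite -big_split/=; apply: eq_big_nat => i /andP[_ i_n].
by rewrite subSn ?(ltnW i_n)// seriesSr mulrDr.
Qed.

(** Sandwich: the partial sums of the product stay below s t, and its first 2n terms contain the
    product of the first n terms of each factor, since the square of side n lies in the triangle of
    side 2n. *)
Lemma hsumM a b s t : nneg_fps a -> nneg_fps b ->
  hsum a s -> hsum b t -> hsum (a * b) (s * t).
Proof.
move=> a0 b0 sa sb; have ab0 := nneg_fpsM a0 b0.
have s0 := hsum_ge0 a0 sa; have t0 := hsum_ge0 b0 sb.
have upper n : series (a * b) n <= s * t.
  rewrite series_fpsM; apply: (@le_trans _ _ (series a n * t)); last first.
    by rewrite ler_wpM2r//; apply: hsum_le.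
  rewrite /series/= mulr_suml; apply: ler_sum => i _.
  by rewrite ler_wpM2l//; apply: hsum_le.
have lower n : series a n * series b n <= series (a * b) (n + n)%N.
  rewrite series_fpsM (big_cat_nat (n := n))//= ?leq_addr//.
  rewrite -[leLHS]addr0; apply: lerD; last first.
    apply: sumr_ge0 => i _; rewrite mulr_ge0// /series/=.
    by apply: sumr_ge0.
  rewrite {1}/series/= mulr_suml; apply: ler_sum_nat => i /andP[_ i_n].
  rewrite ler_wpM2l//; have := @nondecreasing_series R b predT 0.
  by apply => //; lia.
have [u su ust] := hsum_bounded ab0 upper.
suff stu : s * t <= u by have -> : s * t = u by apply/eqP; rewrite eq_le stu ust.
apply: (@ler_cvgn _ (fun n => series a n * series b n) (fun=> u)).
- by apply: cvgM; [exact: sa|exact: sb].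
- exact: cvg_cst.
- by move=> n; apply: le_trans (lower n) _; apply: hsum_le.
Qed.

Lemma hsumexp a s k : nneg_fps a -> hsum a s -> hsum (a ^+ k) (s ^+ k).
Proof.
move=> a0 sa; elim: k => [|k IH]; first by rewrite !expr0; apply: hsum1.
by rewrite !exprS; apply: hsumM => //; apply: nneg_fpsexp.
Qed.

(** Monotone convergence for a double series of nonnegative terms. The third hypothesis says that
    each coefficient of [B] is already a finite sum. *)
Lemma hsum_double (A : nat -> fps R) (B : fps R) (e : nat -> R) s :
  (forall m, nneg_fps (A m)) -> (forall m, hsum (A m) (e m)) ->
  (forall M, eqfps M (\sum_(m < M) A m) B) ->
  series e @ \oo --> s -> hsum B s.
Proof.
move=> A0 sA AB se.
have e0 m : 0 <= e m by apply: hsum_ge0 (sA m).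
have ndse : nondecreasing_seq (series e).
  by apply: nondecreasing_series => i _ _.
have le_se n : series e n <= s.
  rewrite -(cvg_lim (@Rhausdorff R) se).
  by apply: nondecreasing_cvgn_le => //; apply/cvg_ex; exists s.
have sAs M : hsum (\sum_(m < M) A m) (series e M).
  rewrite /series/= big_mkord.
  elim/big_ind2 : _ => //; last by move=> *; apply: hsumD.
  by have := @hsum_fin 0 0; rewrite big_geq//; apply.
have sA0 M : nneg_fps (\sum_(m < M) A m) by apply: nneg_fps_sum => m _.
have ABle M n : (\sum_(m < M) A m) n <= B n.
  have -> : B n = (\sum_(m < maxn M n) A m) n by rewrite AB// leq_maxr.
  rewrite !fps_sumE -!(big_mkord predT (fun m => A m n)).
  have := @nondecreasing_series R (fun m => A m n) predT 0.
  by apply; rewrite ?leq_maxl// => i _ _; apply: A0.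
have B0 : nneg_fps B by move=> n; apply: le_trans (ABle n n); apply: sA0.
have upper n : series B n <= s.
  apply: le_trans (le_se n); apply: le_trans (hsum_le n (sA0 n) (sAs n)).
  rewrite le_eqVlt; apply/orP; left; apply/eqP; rewrite /series/=.
  by apply: eq_big_nat => i /andP[_ /ltnW i_n]; rewrite AB.
have [u su us] := hsum_bounded B0 upper.
suff s_u : s <= u by have -> : s = u by apply/eqP; rewrite eq_le s_u us.
rewrite -(cvg_lim (@Rhausdorff R) se); apply: limr_le.
  by apply/cvg_ex; exists s.
apply: nearW => M.
apply: (ler_cvgn (sAs M) su) => n.
by apply: ler_sum => i _; apply: ABle.
Qed.

End FpsSums.

(** * Asymptotics of the tree generating functions *)

(* This is the sum of the family [A] only if [A m] vanishes up to order [m]. *)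
Definition fps_lsum (R : nzRingType) (A : nat -> fps R) : fps R :=
  Fps (fun n => \sum_(m < n) A m n).

Lemma eqfps_lsum (R : comNzRingType) (A : nat -> fps R) M :
  (forall m, eqfps m (A m) 0) -> eqfps M (\sum_(m < M) A m) (fps_lsum A).
Proof.
move=> A0 n nM; rewrite fps_sumE /=.
rewrite -(big_mkord predT (fun m => A m n)) (big_cat_nat (n := n))//= big_mkord.
rewrite [X in _ + X]big_nat_cond [X in _ + X]big1 ?addr0//.
by move=> i /andP[/andP[ni _] _]; rewrite A0.
Qed.

(** Division by 1 - t takes partial sums: a right-hand side that is summable at 1 gives coefficients
    that have a limit. *)
Lemma fps_div1X (R : realType) (b c : fps R) n :
  (1 - fpsX R) * c = b -> c n = series b n.+1.
Proof.
move=> <-; have E m : ((1 - fpsX R) * c) m = c m - (fpsX R * c) m.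
  by rewrite mulrBl mul1r.
elim: n => [|n IH]; rewrite seriesSr E fpsXME.
  by rewrite /series/= big_geq// add0r subr0.
by rewrite -IH addrC subrK.
Qed.

Section Asymptotics.
Variables (R : realType) (k : R).
Hypothesis k1 : 1 < k.
Let a := 1 + k.
Let gc := k / a ^+ 2.
Let Y := a^-1.
(* [Xm m] counts the trees of height at most [m], [X] all finite trees, the
   number of trees with [n] edges being multiplied by [gc ^+ n]. *)
Variables (X : fps R) (Xm : nat -> fps R).
Let g := fpsC gc * fpsX R.
Let U m := X - Xm m.
Hypothesis Xm_0 : Xm 0%N = 0.
Hypothesis Xm_rec : forall m, Xm m.+1 = g + Xm m * Xm m.+1.
Hypothesis Xm_ge0 : forall m, nneg_fps (Xm m).
Hypothesis Xm_lim : forall m, eqfps m (Xm m) X.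
Hypothesis U_ge0 : forall m, nneg_fps (U m).

Let k0 : 0 < k. Proof. exact: lt_trans k1. Qed.
Let a0 : 0 < a. Proof. by rewrite /a; have := k0; lra. Qed.
Let gc0 : 0 < gc. Proof. by rewrite divr_gt0// exprn_gt0. Qed.
Let Y0 : 0 < Y. Proof. by rewrite invr_gt0. Qed.
Let Y12 : Y < 1 / 2.
Proof. by rewrite /Y mul1r ltf_pV2 ?posrE// /a; have := k1; lra. Qed.
Let gcE : gc = Y * (1 - Y).
Proof. by rewrite /gc /Y /a; field; have := k0; lra. Qed.

Let X_rec : X = g + X * X.
Proof.
apply: fpsP => n; rewrite -(@Xm_lim n.+1)// Xm_rec !fpsDE; congr (_ + _).
apply: eqfpsM (leqnn n); first exact: Xm_lim.
by move=> i i_n; rewrite Xm_lim//; lia.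
Qed.

Let X_ge0 : nneg_fps X.
Proof. by move=> n; rewrite -(@Xm_lim n)//; apply: Xm_ge0. Qed.

Let g_ge0 : nneg_fps g.
Proof. by apply: nneg_fpsM; [apply/nneg_fpsC/ltW|exact: nneg_fpsX]. Qed.

Let sum_g : hsum g gc.
Proof.
rewrite -[gc]mulr1; apply: hsumM; [|exact: nneg_fpsX|exact: hsumC|exact: hsumX].
exact/nneg_fpsC/ltW.
Qed.

(** The bound is the smaller root of y = gc + y^2. By positivity, partial sums at 1 satisfy p_(m+1)
    <= gc + p_m p_(m+1); if p_m <= Y, then p_(m+1) (1 - Y) <= gc = Y (1 - Y). *)
Let Xm_le m n : series (Xm m) n <= Y.
Proof.
elim: m n => [|m IH] n.
  by rewrite Xm_0 /series/= big1// ltW.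
suff : series (Xm m.+1) n * (1 - Y) <= Y * (1 - Y).
  by rewrite ler_pM2r//; have := Y12; lra.
rewrite -gcE mulrBr mulr1 lerBlDr {1}Xm_rec.
have -> : series (g + Xm m * Xm m.+1) n = series g n + series (Xm m * Xm m.+1) n.
  by rewrite /series/= -big_split.
apply: lerD; first exact: hsum_le.
rewrite [leRHS]mulrC series_fpsM; apply: (@le_trans _ _ (series (Xm m) n * series (Xm m.+1) n)).
  have -> : series (Xm m) n = \sum_(0 <= i < n) Xm m i by [].
  rewrite mulr_suml; apply: ler_sum_nat => i /andP[_ i_n].
  rewrite ler_wpM2l ?Xm_ge0//.
  by apply: (@nondecreasing_series R (Xm m.+1) predT 0) => //; [move=> *; apply: Xm_ge0|lia].
by rewrite ler_wpM2r ?IH//; apply: sumr_ge0 => i _; apply: Xm_ge0.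
Qed.

Let x := k^-1.
Let z m := x ^+ m.
(** Closed form of the recursion y_(m+1) = gc / (1 - y_m) started at 0. This homography fixes Y and
    1 - Y, with multiplier Y / (1 - Y) = 1/k at Y: hence [x] and its powers [z m]. *)
Let y m := Y * (1 - z m) / (1 - x * z m).
Let u m := Y - y m.

Let x0 : 0 < x. Proof. by rewrite invr_gt0. Qed.
Let x1 : x < 1. Proof. by rewrite invf_lt1. Qed.
Let z_gt0 m : 0 < z m. Proof. by rewrite exprn_gt0. Qed.
Let z_le1 m : z m <= 1. Proof. by rewrite exprn_ile1 ?ltW. Qed.
Let xz_lt1 m : 0 < 1 - x * z m.
Proof.
rewrite subr_gt0; apply: le_lt_trans x1.
by rewrite -[leRHS]mulr1 ler_wpM2l// ltW.
Qed.
Let Yx : Y = x / (1 + x).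
Proof. by rewrite /Y /a /x; field; have := k0; lra. Qed.

Let uE m : u m = Y * (z m * (1 - x) / (1 - x * z m)).
Proof. by rewrite /u /y; field; have := xz_lt1 m; lra. Qed.

Let y_rec m : y m.+1 * (1 - y m) = gc.
Proof.
have H1 := xz_lt1 m; have H2 := xz_lt1 m.+1.
rewrite /y gcE Yx /z exprS -!/(z m) in H2 *.
by field; rewrite !gt_eqF//; have := x0; lra.
Qed.

Let sum_Xm m : hsum (Xm m) (y m).
Proof.
elim: m => [|m IH].
  rewrite Xm_0 /y /z expr0 subrr mulr0 mul0r.
  by have := @hsum_fin R 0 0; rewrite big_geq//; apply.
have [t st tY] := hsum_bounded (@Xm_ge0 m.+1) (Xm_le m.+1).
suff -> : y m.+1 = t by [].
have := hsumD sum_g (hsumM (@Xm_ge0 _) (@Xm_ge0 _) IH st).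
rewrite -Xm_rec => /(hsum_unique st) E.
have H : 1 - y m != 0.
  by apply/eqP => H; have := y_rec m; rewrite H mulr0 => gE; have := gc0; rewrite -gE ltxx.
by apply: (mulIf H); rewrite y_rec mulrBr mulr1 {1}E; ring.
Qed.

(** The value solves t = gc + t^2, whose roots are Y and 1 - Y; the bound t <= Y < 1/2 excludes the
    second. *)
Let sum_X : hsum X Y.
Proof.
have XY n : series X n <= Y.
  apply: le_trans (Xm_le n n); apply: ler_sum_nat => i /andP[_ /ltnW i_n].
  by rewrite Xm_lim.
have [t st tY] := hsum_bounded X_ge0 XY.
have := hsumD sum_g (hsumM X_ge0 X_ge0 st st).
rewrite -X_rec => /(hsum_unique st) E.
suff -> : Y = t by [].
have : (Y - t) * (1 - Y - t) = 0.
  have -> : (Y - t) * (1 - Y - t) = gc + t * t - t by rewrite gcE; ring.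
  by rewrite -E subrr.
move/eqP; rewrite mulf_eq0 => /orP[|] /eqP; first by lra.
by have := Y12; lra.
Qed.

Let sum_U m : hsum (U m) (u m). Proof. exact: hsumB. Qed.

Let U_rec m : (1 - X) * U m.+1 = X * U m - U m * U m.+1.
Proof.
have -> : (1 - X) * U m.+1 = X - X * X - (Xm m.+1 - X * Xm m.+1).
  by rewrite /U; ring.
by rewrite {1}X_rec {1}Xm_rec /U; ring.
Qed.

Let U_low m : eqfps m (U m) 0.
Proof. by move=> n n_m; rewrite /U fpsBE Xm_lim// subrr. Qed.

Let eqfps_mull0 m (b c : fps R) : eqfps m b 0 -> eqfps m (c * b) 0.
Proof. by move=> b0; rewrite -[0](mulr0 c); apply: eqfpsM. Qed.

Let S := fps_lsum (fun m => fpsC (k ^+ m) * U m).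
Let Q := fps_lsum (fun m => fpsC (k ^+ m) * (U m * U m.+1)).

(** Summing [U_rec] against k^m telescopes. The boundary term carries [U M], which has no
    coefficient of degree at most M, so that it disappears from each fixed coefficient. *)
Let S_fin M : (1 - fpsC a * X) * (\sum_(m < M) fpsC (k ^+ m) * U m) =
  g - fpsC k * (\sum_(m < M) fpsC (k ^+ m) * (U m * U m.+1))
    - (1 - X) * (fpsC (k ^+ M) * U M).
Proof.
elim: M => [|M IH].
  rewrite !big_ord0 !mulr0 expr0 fpsC1 mul1r subr0 /U Xm_0 subr0.
  by rewrite mulrBl mul1r {1}X_rec; ring.
rewrite !big_ord_recr/= mulrDr IH exprS fpsCM /a fpsCD fpsC1.
set s := \sum_(i < M) _; set c := fpsC (k ^+ M); set d := fpsC k.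
have -> : (1 - X) * (d * c * U M.+1) = d * c * ((1 - X) * U M.+1) by ring.
by rewrite U_rec; ring.
Qed.

Let S_eq : (1 - fpsC a * X) * S = g - fpsC k * Q.
Proof.
apply: fpsP => n.
have SE : eqfps n (\sum_(m < n) fpsC (k ^+ m) * U m) S.
  by apply: eqfps_lsum => m; apply: eqfps_mull0.
have QE : eqfps n (\sum_(m < n) fpsC (k ^+ m) * (U m * U m.+1)) Q.
  apply: eqfps_lsum => m; apply: eqfps_mull0; rewrite mulrC.
  exact: eqfps_mull0.
rewrite -(eqfpsM (@eqfps_refl _ n _) SE (leqnn n)) S_fin.
rewrite -[in RHS](addr0 (g - _)); apply: (eqfpsD _ _ (leqnn n)).
  by apply: eqfpsD => //; apply: eqfpsN; apply: eqfpsM.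
rewrite -oppr0; apply: eqfpsN; apply: eqfps_mull0.
exact: eqfps_mull0.
Qed.

(* As [X (1 - X) = g], the product of [1 - a X] and its conjugate
   [1 - a (1 - X)] is [- k (1 - t)]: the only singularity of [S] within the
   relevant disc is the simple pole at [t = 1]. *)
Let S_eq2 : (1 - fpsX R) * S = (1 - fpsC (a / k) * X) * (g - fpsC k * Q).
Proof.
rewrite -S_eq mulrA; congr (_ * _).
have -> : (1 - fpsC (a / k) * X) * (1 - fpsC a * X) =
  1 - (fpsC (a / k) + fpsC a) * X + fpsC (a / k) * fpsC a * (X * X) by ring.
have -> : X * X = X - g by rewrite {3}X_rec; ring.
rewrite -fpsCD -fpsCM mulrBr /g mulrA -fpsCM.
have -> : a / k * a * gc = 1 by rewrite /gc; field; have := a0; have := k0; lra.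
have -> : a / k + a = a / k * a by rewrite /a; field; have := k0; lra.
by rewrite fpsC1; ring.
Qed.

Let q := (Y - Y * (1 - x)) / a.

Let ku_cvg : k ^+ m * u m @[m --> \oo] --> Y * (1 - x).
Proof.
have -> : (fun m => k ^+ m * u m) = (fun m => Y * (1 - x) / (1 - x * z m)).
  apply: funext => m; rewrite uE.
  have -> : k ^+ m = (z m)^-1 by rewrite /z /x exprVn invrK.
  by field; have := xz_lt1 m; have := z_gt0 m; lra.
have zc : z m @[m --> \oo] --> (0 : R).
  by apply: cvg_expr; rewrite ger0_norm// ltW.
rewrite -[Y * _ in X in _ --> X]divr1; apply: cvgM; first exact: cvg_cst.
apply: cvgV; first exact: oner_neq0.
rewrite -[in X in _ --> X](subr0 1) -(mulr0 x).
by apply: cvgB; [exact: cvg_cst|apply: cvgM => //; exact: cvg_cst].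
Qed.

(** At t = 1 the factor 1 - a X vanishes because a Y = 1. The recursion becomes k u_(m+1) = u_m - a
    u_m u_(m+1), and the sum telescopes to (Y - k^M u_M) / a, whose limit is [q]. *)
Let sum_q : series (fun m => k ^+ m * (u m * u m.+1)) @ \oo --> q.
Proof.
have -> : series (fun m => k ^+ m * (u m * u m.+1)) =
    (fun M => (Y - k ^+ M * u M) / a).
  apply: funext; elim=> [|M IH].
    rewrite /series/= big_geq// expr0 mul1r uE /z expr0.
    by field; have := a0; have := x1; lra.
  rewrite seriesSr IH.
  have : (1 - Y) * u M.+1 = Y * u M - u M * u M.+1.
    have := y_rec M; rewrite gcE /u => E; have : (1 - Y) * (Y - y M.+1) =
       (1 - Y) * Y - y M.+1 * (1 - y M) - y M * y M.+1 + y M.+1 * Y by ring.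
    by rewrite E => ->; ring.
  have -> : 1 - Y = k * Y by rewrite /Y /a; field; have := k0; lra.
  have aY : Y = a^-1 by [].
  have E2 : Y * a = 1 by rewrite aY mulVf// gt_eqF.
  move=> E; have : k * u M.+1 = u M - a * (u M * u M.+1).
    have -> : k * u M.+1 = a * (k * Y * u M.+1).
      by rewrite -[LHS]mul1r -E2; ring.
    by rewrite E mulrBr (mulrA a Y) (mulrC a Y) E2 mul1r.
  move=> E3; have -> : k ^+ M.+1 * u M.+1 = k ^+ M * (k * u M.+1).
    by rewrite exprS; ring.
  rewrite E3; field; have := a0; lra.
apply: cvgM; last exact: cvg_cst.
by apply: cvgB => //; exact: cvg_cst.
Qed.


Let sum_Q : hsum Q q.
Proof.
have UU0 m : nneg_fps (U m * U m.+1) by apply: nneg_fpsM; apply: U_ge0.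
have kk0 m : nneg_fps (fpsC (k ^+ m)) by apply/nneg_fpsC/exprn_ge0/ltW.
apply: (hsum_double (A := fun m => fpsC (k ^+ m) * (U m * U m.+1)) _ _ _ sum_q) => [m|m|M].
- exact: nneg_fpsM.
- by apply: hsumM => //; [exact: hsumC|exact: hsumM].
- apply: eqfps_lsum => m; apply: eqfps_mull0; rewrite mulrC.
  exact: eqfps_mull0.
Qed.

(** The right-hand side of [S_eq2] evaluated at 1, where 1 - (a/k) Y = 1 - x. *)
Let sigma := (1 - x) * (gc - k * q).

Let sigma_gt0 : 0 < sigma.
Proof.
rewrite /sigma mulr_gt0//; first by rewrite subr_gt0.
have -> : gc - k * q = k / a * (Y * (1 - x)).
  by rewrite /q /gc /Y; field; have := a0; lra.
by rewrite !mulr_gt0 ?divr_gt0 ?subr_gt0.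
Qed.

Let XS_cvg j : (X ^+ j * S) n @[n --> \oo] --> Y ^+ j * sigma.
Proof.
have Q0 : nneg_fps Q.
  move=> n; apply: sumr_ge0 => m _; apply: nneg_fpsM.
    exact/nneg_fpsC/exprn_ge0/ltW.
  by apply: nneg_fpsM; apply: U_ge0.
(* The right-hand side is expanded into four products of nonnegative series, since [hsumM] applies
   only to nonnegative factors. *)
have H : (1 - fpsX R) * (X ^+ j * S) =
  (X ^+ j * g - X ^+ j * (fpsC k * Q)) -
  (fpsC (a / k) * X ^+ j.+1 * g - fpsC (a / k) * X ^+ j.+1 * (fpsC k * Q)).
  by rewrite mulrCA S_eq2 exprS; ring.
have -> : (fun n => (X ^+ j * S) n) =
    (fun n => [sequence series ((1 - fpsX R) * (X ^+ j * S)) n.+1]_n n).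
  by apply: funext => n; exact: fps_div1X.
rewrite cvg_shiftS.
have -> : Y ^+ j * sigma = (Y ^+ j * gc - Y ^+ j * (k * q)) -
    (a / k * Y ^+ j.+1 * gc - a / k * Y ^+ j.+1 * (k * q)).
  by rewrite /sigma exprS /Y /x; field; have := a0; have := k0; lra.
rewrite H.
have Xj0 i : nneg_fps (X ^+ i) by exact: nneg_fpsexp.
have sXj i : hsum (X ^+ i) (Y ^+ i) by exact: hsumexp.
have k_0 := nneg_fpsC (ltW k0).
have ak0 : nneg_fps (fpsC (a / k)) by apply/nneg_fpsC/ltW/divr_gt0.
have skQ : hsum (fpsC k * Q) (k * q) by apply: hsumM => //; exact: hsumC.
have kQ0 : nneg_fps (fpsC k * Q) by exact: nneg_fpsM.
have sakX : hsum (fpsC (a / k) * X ^+ j.+1) (a / k * Y ^+ j.+1).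
  by apply: hsumM => //; exact: hsumC.
have akX0 : nneg_fps (fpsC (a / k) * X ^+ j.+1) by exact: nneg_fpsM.
by apply: hsumB; apply: hsumB; apply: hsumM.
Qed.

(* [X ^+ K - Xm m ^+ K] is [K X ^+ (K - 1) U m] up to a term of second order in
   [U m], whose contribution converges at the critical point. *)
Let E K m := K%:R * X ^+ (K - 1) * U m - (X ^+ K - Xm m ^+ K).
Let e K m := K%:R * Y ^+ (K - 1) * u m - (Y ^+ K - y m ^+ K).

(** All terms on the right are nonnegative. By induction on K, this recursion gives the positivity
    of [E], and its analogue at 1 gives the quadratic bound [e_le]. *)
Let E_rec K m : E K.+1 m = X * E K m + U m * (X ^+ K - Xm m ^+ K).
Proof.
rewrite /E subSS subn0 -natr1 !exprS; case: K => [|K].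
  by rewrite /U; ring.
by rewrite subSS subn0 !exprS /U; ring.
Qed.
Let e_rec K m : e K.+1 m = Y * e K m + u m * (Y ^+ K - y m ^+ K).
Proof.
rewrite /e subSS subn0 -natr1 !exprS; case: K => [|K].
  by rewrite /u; ring.
by rewrite subSS subn0 !exprS /u; ring.
Qed.

Let pow_ge0 K m : nneg_fps (X ^+ K - Xm m ^+ K).
Proof.
elim: K => [|K IH]; first by rewrite !expr0 subrr.
have -> : X ^+ K.+1 - Xm m ^+ K.+1 = X * (X ^+ K - Xm m ^+ K) + U m * Xm m ^+ K.
  by rewrite /U !exprS; ring.
by apply: nneg_fpsD; apply: nneg_fpsM => //; exact: nneg_fpsexp.
Qed.

Let pow_low K m : eqfps m (X ^+ K - Xm m ^+ K) 0.
Proof.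
move=> n nm; rewrite fpsBE.
by have -> : (Xm m ^+ K) n = (X ^+ K) n; [exact: eqfpsX nm|rewrite subrr].
Qed.

Let E_ge0 K m : nneg_fps (E K m).
Proof.
elim: K => [|K IH]; first by rewrite /E !mul0r !expr0 subrr subr0.
by rewrite E_rec; apply: nneg_fpsD; apply: nneg_fpsM.
Qed.

Let sum_E K m : hsum (E K m) (e K m).
Proof.
have sn : hsum (K%:R : fps R) K%:R by rewrite -fpsCn; exact: hsumC.
have n0 : nneg_fps (K%:R : fps R) by rewrite -fpsCn; exact: nneg_fpsC.
apply: hsumB; last by apply: hsumB; exact: hsumexp.
apply: hsumM => //; first by apply: nneg_fpsM => //; exact: nneg_fpsexp.
by apply: hsumM => //; [exact: nneg_fpsexp|exact: hsumexp].
Qed.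

Let u_ge0 m : 0 <= u m. Proof. exact: hsum_ge0 (@U_ge0 m) (@sum_U m). Qed.
Let u_le m : u m <= z m.
Proof.
rewrite uE; have Y1 : Y <= 1 by have := Y12; lra.
have h := xz_lt1 m.
apply: (@le_trans _ _ (1 * (z m * (1 - x) / (1 - x * z m)))).
  by rewrite ler_wpM2r//; apply/ltW/divr_gt0 => //; rewrite mulr_gt0 ?subr_gt0.
rewrite mul1r ler_pdivrMr// ler_wpM2l ?(ltW (z_gt0 m))// lerD2l lerN2.
by rewrite -[leRHS]mulr1 ler_wpM2l// ltW.
Qed.
Let y_ge0 m : 0 <= y m. Proof. exact: hsum_ge0 (@Xm_ge0 m) (@sum_Xm m). Qed.

Let powu K m : 0 <= Y ^+ K - y m ^+ K <= K%:R * u m.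
Proof.
apply/andP; split.
  by apply: (hsum_ge0 (@pow_ge0 K m)); apply: hsumB; exact: hsumexp.
elim: K => [|K IH]; first by rewrite !expr0 subrr mul0r.
have -> : Y ^+ K.+1 - y m ^+ K.+1 = Y * (Y ^+ K - y m ^+ K) + u m * y m ^+ K.
  by rewrite /u !exprS; ring.
have Y1 : Y <= 1 by have := Y12; lra.
have y1 : y m <= 1 by have := u_ge0 m; rewrite /u; lra.
have -> : K.+1%:R * u m = K%:R * u m + u m by rewrite -natr1; ring.
apply: lerD; last first.
  by rewrite -[leRHS]mulr1 ler_wpM2l ?exprn_ile1.
apply: (@le_trans _ _ (Y * (K%:R * u m))); first by rewrite ler_wpM2l// ltW.
by rewrite -[leRHS]mul1r ler_wpM2r// mulr_ge0.
Qed.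

Let e_le K m : e K m <= (K * K)%:R * (u m * u m).
Proof.
elim: K => [|K IH]; first by rewrite /e !mul0r !expr0 subrr subr0.
have /andP[p0 p1] := powu K m; have e0 := hsum_ge0 (@E_ge0 K m) (@sum_E K m).
have Y1 : Y <= 1 by have := Y12; lra.
rewrite e_rec; apply: (@le_trans _ _ (e K m + u m * (K%:R * u m))).
  apply: lerD; last by rewrite ler_wpM2l.
  by rewrite -[leRHS]mul1r ler_wpM2r.
apply: (@le_trans _ _ ((K * K)%:R * (u m * u m) + u m * (K%:R * u m))).
  by rewrite lerD2r.
have -> : u m * (K%:R * u m) = K%:R * (u m * u m) by ring.
rewrite -mulrDl ler_wpM2r ?mulr_ge0//.
have -> : (K * K)%:R + K%:R = (K * K + K)%:R :> R by rewrite natrD.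
by rewrite ler_nat mulnS mulSn (addnC (K * K)%N) leq_addl.
Qed.

Let lsumE_low K M : eqfps M (\sum_(m < M) fpsC (k ^+ m) * E K m)
  (fps_lsum (fun m => fpsC (k ^+ m) * E K m)).
Proof.
apply: eqfps_lsum => m; apply: eqfps_mull0 => n nm; rewrite /E fpsBE.
rewrite (_ : (_ * U m) n = 0); last exact: (@eqfps_mull0 m).
by rewrite (@pow_low K m n nm) subrr.
Qed.

(** As e_m <= K^2 u_m^2 and u_m <= k^-m, the values k^m e_m are dominated by a geometric series of
    ratio 1/k; a series convergent at 1 has coefficients tending to 0. *)
Let lsumE_cvg0 K : fps_lsum (fun m => fpsC (k ^+ m) * E K m) n @[n --> \oo] --> (0 : R).
Proof.
have e0 m : 0 <= e K m by exact: hsum_ge0 (@E_ge0 K m) (@sum_E K m).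
have [s ss] : exists s : R, series (fun m => k ^+ m * e K m) @ \oo --> s.
  apply/cvg_ex; apply: (@series_le_cvg _ _ (geometric (K * K)%:R x)) => //.
  - by move=> m; rewrite mulr_ge0// exprn_ge0// ltW.
  - by move=> m; rewrite mulr_ge0// exprn_ge0// ltW.
  - move=> m; apply: (@le_trans _ _ (k ^+ m * ((K * K)%:R * (z m * z m)))).
      rewrite ler_wpM2l ?exprn_ge0 ?(ltW k0)//; apply: le_trans (e_le K m) _.
      by rewrite ler_wpM2l// ler_pM.
    rewrite le_eqVlt; apply/orP; left; apply/eqP => /=.
    have -> : k ^+ m = (z m)^-1 by rewrite /z /x exprVn invrK.
    by rewrite -/(z m); field; have := z_gt0 m; lra.
  - by apply: is_cvg_geometric_series; rewrite ger0_norm// ltW.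
have kk0 m : nneg_fps (fpsC (k ^+ m)) by apply/nneg_fpsC/exprn_ge0/ltW.
suff : hsum (fps_lsum (fun m => fpsC (k ^+ m) * E K m)) s by exact: hsum0.
apply: (hsum_double (A := fun m => fpsC (k ^+ m) * E K m) _ _ _ ss) => [m|m|M].
- exact: nneg_fpsM.
- by apply: hsumM => //; exact: hsumC.
- exact: lsumE_low.
Qed.

(** The constant is quantified before [K]: being common to all K, it cancels when the weight of a
    ball is divided by the partition function. *)
Lemma fps_tail_sum_cvg : exists2 sigma : R, 0 < sigma & forall K : nat,
  (X ^+ K + fpsC (k - 1) *
    fps_lsum (fun m => fpsC (k ^+ m) * (X ^+ K - Xm m ^+ K))) n @[n --> \oo]
  --> K%:R * Y ^+ (K - 1) * sigma.
Proof.
exists ((k - 1) * sigma) => [|K]; first by rewrite mulr_gt0// subr_gt0.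
have XK0 : (X ^+ K) n @[n --> \oo] --> (0 : R).
  have : hsum (X ^+ K) (Y ^+ K) by exact: hsumexp.
  exact: hsum0.
have -> : fps_lsum (fun m => fpsC (k ^+ m) * (X ^+ K - Xm m ^+ K)) =
    K%:R * (X ^+ (K - 1) * S) - fps_lsum (fun m => fpsC (k ^+ m) * E K m).
  apply: fpsP => n.
  rewrite -(@eqfps_lsum _ _ n) //; last by move=> m; exact: eqfps_mull0.
  have SE : eqfps n (\sum_(m < n) fpsC (k ^+ m) * U m) S.
    by apply: eqfps_lsum => m; apply: eqfps_mull0.
  have EE := @lsumE_low K n.
  have := eqfpsD (eqfpsM (@eqfps_refl _ n K%:R)
    (eqfpsM (@eqfps_refl _ n (X ^+ (K - 1))) SE)) (eqfpsN EE).
  move/(_ n (leqnn n)) <-; congr (fcoef _ n).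
  rewrite !mulr_sumr -sumrB; apply: eq_bigr => m _.
  by rewrite /E; ring.
have -> : K%:R * Y ^+ (K - 1) * ((k - 1) * sigma) =
  0 + (k - 1) * (K%:R * (Y ^+ (K - 1) * sigma) - 0) by ring.
have -> : (fun n => (X ^+ K + fpsC (k - 1) * (K%:R * (X ^+ (K - 1) * S) -
     fps_lsum (fun m => fpsC (k ^+ m) * E K m))) n) =
  (fun n => (X ^+ K) n + (k - 1) * (K%:R * (X ^+ (K - 1) * S) n -
     fps_lsum (fun m => fpsC (k ^+ m) * E K m) n)).
  by apply: funext => n; rewrite fpsDE fpsCME fpsBE -fpsCn fpsCME.
apply: cvgD => //; apply: cvgM; first exact: cvg_cst.
apply: cvgB; last exact: lsumE_cvg0.
by apply: cvgM; [exact: cvg_cst|exact: XS_cvg].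
Qed.

End Asymptotics.

(** * Truncation and grafting of trees *)

Section Trees.
Implicit Types (T V : tree) (S : seq nat -> tree) (v w u : seq nat) (r m n i j : nat).

Lemma treeP T T' : (forall v, tverts T v <-> tverts T' v) -> T = T'.
Proof.
case: T T' => [V ax] [V' ax'] /= VV'.
have E : V = V' by apply/seteqP; split => v /VV'.
by move: ax'; rewrite -E => ax'; rewrite (Prop_irrelevance ax ax').
Qed.

Lemma tree_nil T : tverts T [::]. Proof. by case: (tree_ax T). Qed.
Lemma tree_0 T : tverts T [:: 0%N]. Proof. by case: (tree_ax T) => _ []. Qed.
Lemma tree_rcons T v i : tverts T (rcons v i) -> tverts T v.
Proof. by case: (tree_ax T) => _ _ + _ _ => /[apply]. Qed.
Lemma tree_prefix T v u : tverts T (v ++ u) -> tverts T v.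
Proof.
elim/last_ind: u => [|u i IH]; first by rewrite cats0.
by rewrite -rcons_cat => /tree_rcons/IH.
Qed.
Lemma tree_take T n v : tverts T v -> tverts T (take n v).
Proof. by move=> Tv; apply: (@tree_prefix T _ (drop n v)); rewrite cat_take_drop. Qed.
Lemma tree_sib T v i j : (j <= i)%N -> tverts T (rcons v i) -> tverts T (rcons v j).
Proof.
case: (tree_ax T) => _ _ _ sib _; elim: i => [|i IH].
  by rewrite leqn0 => /eqP ->.
by rewrite leq_eqVlt => /orP[/eqP -> //|ji] /sib; apply: IH.
Qed.
Lemma tree_locfin T v : exists n, ~ tverts T (rcons v n).
Proof. by case: (tree_ax T). Qed.
Lemma tree_head T i v : tverts T (i :: v) -> i = 0%N.
Proof.
move=> Tiv; have : tverts T [:: i] by apply: (@tree_prefix T _ v).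
case: i {Tiv} => [//|i] Ti; case: (tree_ax T) => _ [_ n1] _ _ _.
by case: n1; apply: (@tree_sib T [::] i.+1 1).
Qed.

Lemma tree_children T v : tverts T v ->
  exists n, forall i, tverts T (rcons v i) <-> (i < n)%N.
Proof.
move=> Tv; have [N TN] := tree_locfin T v.
have ex : exists n, ~~ `[< tverts T (rcons v n) >] by exists N; apply/asboolPn.
exists (ex_minn ex) => i; case: ex_minnP => n /asboolPn Tn min; split.
  by move=> Ti; rewrite ltnNge; apply/negP => /tree_sib/(_ Ti).
by move=> i_n; apply: contrapT => /asboolPn/min; rewrite leqNgt i_n.
Qed.

Lemma trunc_ax r T : is_tree (trunc r.+1 T).
Proof.
split => /=.
- by split => //; apply: tree_nil.
- split; first by split => //; apply: tree_0.
  by move=> [/tree_head].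
- move=> v i [Tv]; rewrite size_rcons => /ltnW sv; split => //.
  exact: tree_rcons Tv.
- move=> v i [Tv]; rewrite size_rcons => sv; split; last by rewrite size_rcons.
  exact: tree_sib Tv.
- by move=> v; have [n Tn] := tree_locfin T v; exists n => -[].
Qed.
(* Truncation at height [r + 1]: the truncation at height 0 is not a tree. *)
Definition truncT r T := Tree (trunc_ax r T).

(** A height bound that keeps its meaning on infinite trees, unlike [height]. *)
Definition hle m T := forall v, tverts T v -> (size v <= m)%N.

Lemma finite_trunc r T : finite_set (trunc r T).
Proof.
elim: r => [|r IH].
  apply: (@sub_finite_set _ _ [set [::]]) => // v [_].
  by rewrite leqn0 size_eq0 => /eqP.
have [n Hn] := choice (fun v => tree_locfin T v).
apply: (@sub_finite_set _ _ ([set [::]] `|`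
  \bigcup_(v in trunc r T) [set rcons v i | i in `I_(n v)])).
  move=> v; elim/last_ind: v => [|v i _]; first by left.
  move=> [Tv]; rewrite size_rcons ltnS => sv; right.
  exists v; first by split=> //; apply: tree_rcons Tv.
  exists i => //=; rewrite ltnNge; apply/negP => ni; apply: (Hn v).
  exact: tree_sib Tv.
rewrite finite_setU; split => //; apply: bigcup_finite => // v _.
exact/finite_image/finite_II.
Qed.

Lemma tfin_truncT r T : tfin (truncT r T).
Proof. exact: finite_trunc. Qed.

Lemma truncT_id r T : hle r.+1 T -> truncT r T = T.
Proof. by move=> hT; apply: treeP => v /=; split => [[]|Tv] //; split => //; apply: hT. Qed.
Lemma hle_truncT r T : hle r.+1 (truncT r T).
Proof. by move=> v []. Qed.
Lemma truncT_truncT r r' T : (r <= r')%N -> truncT r (truncT r' T) = truncT r T.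
Proof.
move=> rr'; apply: treeP => v /=; split=> [[[]]|[Tv sv]]; first by [].
by split => //; split => //; apply: leq_trans sv _.
Qed.
Lemma truncT_eq r T T' : truncT r T = truncT r T' <-> trunc r.+1 T = trunc r.+1 T'.
Proof. by split=> [[]//|E]; apply: treeP => v /=; rewrite E. Qed.

Definition vs T := fset_set (tverts T).
Lemma in_vs T v : tfin T -> (v \in vs T) <-> tverts T v.
Proof. by move=> Tfin; rewrite /vs in_fset_set//; split => [/set_mem|/mem_set]. Qed.

Lemma heightP T m : tfin T -> (height T <= m)%N <-> hle m T.
Proof.
move=> Tfin; rewrite /height; split.
  by move=> /bigmax_leqP_seq H v Tv; apply: H => //; apply/in_vs.
by move=> hT; apply/bigmax_leqP_seq => v /in_vs-/(_ Tfin)/hT.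
Qed.
Lemma hle_height T : tfin T -> hle (height T) T.
Proof. by move=> Tfin; apply/heightP. Qed.

Lemma finite_Dr r T : finite_set (Dr r T).
Proof.
by apply: sub_finite_set (finite_trunc r T) => v [Tv <-].
Qed.
Definition DrF r T := fset_set (Dr r T).
Lemma in_DrF r T w : (w \in DrF r T) <-> Dr r T w.
Proof. by rewrite /DrF in_fset_set; [split => [/set_mem|/mem_set]|exact: finite_Dr]. Qed.

(* The branch above [w], planted on a copy [[::]] of the parent of [w]: the vertex
   [w ++ u] of [T] becomes [0 :: u]. *)
Definition sub_verts T w : set (seq nat) :=
  [set v | if v is i :: u then i = 0%N /\ tverts T (w ++ u) else True].

Lemma sub_ax T w : tverts T w -> is_tree (sub_verts T w).
Proof.
move=> Tw; split => //=.
- by rewrite cats0; split => // -[].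
- move=> [|j u] i //= [-> H]; split=> //.
  by apply: (@tree_rcons T _ i); rewrite rcons_cat.
- move=> [|j u] i /=; first by case.
  move=> [-> H].
  by split=> //; rewrite -rcons_cat; apply: (@tree_sib T _ i.+1); rewrite ?rcons_cat.
- move=> [|j u]; first by exists 1%N => /= -[].
  by have [n Tn] := tree_locfin T (w ++ u); exists n => /= -[_]; rewrite -rcons_cat.
Qed.

Definition sub T w :=
  if pselect (tverts T w) is left Tw then Tree (sub_ax Tw) else tree1.

Lemma subE T w v : tverts T w -> tverts (sub T w) v <->
  if v is i :: u then i = 0%N /\ tverts T (w ++ u) else True.
Proof. by rewrite /sub; case: pselect. Qed.

(* The inverse construction: [S w] is planted at each vertex [w] of [V] of height
   [r + 1]; its root and first vertex are the last edge of [V] leading to [w]. *)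
Definition graft_verts r V S : set (seq nat) :=
  [set v | tverts V (take r.+1 v) /\ tverts (S (take r.+1 v)) (0%N :: drop r.+1 v)].

Lemma take_drop_rcons r v i :
  if (size v < r)%N then [/\ take r (rcons v i) = rcons v i,
    drop r (rcons v i) = [::], take r v = v & drop r v = [::]]
  else take r (rcons v i) = take r v /\ drop r (rcons v i) = rcons (drop r v) i.
Proof.
case: ltnP => sv.
  by rewrite !take_oversize ?drop_oversize ?size_rcons// ltnW.
rewrite -!cats1 takel_cat// drop_cat; split => //.
by case: ltngtP sv => // -> _; rewrite subnn drop0 drop_size.
Qed.

Lemma graft_ax r V S : is_tree (graft_verts r V S).
Proof.
split.
- by split; [exact: tree_nil|exact: tree_0].
- split; first by split; [exact: tree_0|exact: tree_0].
  by move=> [/= /tree_head].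
- move=> v i; rewrite /graft_verts /=; have := take_drop_rcons r.+1 v i.
  case: ifP => _; last by move=> [-> ->] [? H]; split=> //; apply: (@tree_rcons _ _ i).
  by move=> [-> -> -> ->] [/tree_rcons ? _]; split=> //; apply: tree_0.
- move=> v i; rewrite /graft_verts /=.
  have := take_drop_rcons r.+1 v i; have := take_drop_rcons r.+1 v i.+1.
  case: ifP => _.
    move=> [-> -> _ _] [-> -> _ _] [H _]; split; last exact: tree_0.
    exact: tree_sib H.
  move=> [-> ->] [-> ->] [? H]; split=> //.
  exact: (@tree_sib _ (0%N :: _) i.+1).
- move=> v; rewrite /graft_verts /=; case: (ltnP (size v) r.+1) => sv.
    have [n Vn] := tree_locfin V v; exists n.
    by have := take_drop_rcons r.+1 v n; rewrite sv => -[-> -> _ _] [].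
  have [n Sn] := tree_locfin (S (take r.+1 v)) (0%N :: drop r.+1 v); exists n.
  by have := take_drop_rcons r.+1 v n; rewrite ltnNge sv/= => -[-> ->] [].
Qed.
Definition graft r V S := Tree (graft_ax r V S).

(** Below height r + 1 the condition on [S] concerns the vertex [:: 0], which lies in every tree;
    only the values at the top vertices of [V] count. *)
Lemma graft_ext r V S S' :
  (forall w, Dr r.+1 V w -> S w = S' w) -> graft r V S = graft r V S'.
Proof.
move=> SS'; apply: treeP => v /=; split; case: (leqP r.+1 (size v)) => sv [Vv Sv];
  split => //.
- by rewrite -SS'//; split=> //; rewrite size_takel.
- by rewrite drop_oversize ?(ltnW sv)//; apply: tree_0.
- by rewrite SS'//; split=> //; rewrite size_takel.
- by rewrite drop_oversize ?(ltnW sv)//; apply: tree_0.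
Qed.

Lemma truncT_graft r V S : hle r.+1 V -> truncT r (graft r V S) = V.
Proof.
move=> hV; apply: treeP => v /=; split=> [[[]]|Vv].
  by move=> + _ sv; rewrite take_oversize.
split; last exact: hV.
by rewrite /= /graft_verts /= take_oversize ?hV// drop_oversize ?hV//; split => //; apply: tree_0.
Qed.

Lemma sub_graft r V S w : Dr r.+1 V w -> sub (graft r V S) w = S w.
Proof.
move=> [Vw sw]; have Gw : tverts (graft r V S) w.
  by rewrite /= /graft_verts /= -sw take_size drop_size; split=> //; apply: tree_0.
apply: treeP => -[|i u]; first by split=> _; [exact: tree_nil|apply/subE].
split=> [/subE-/(_ Gw) [-> /=]|H].
  by rewrite /graft_verts /= -sw take_size_cat// drop_size_cat// => -[].
apply/subE => //; have i0 := tree_head H; split=> //.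
by rewrite /= /graft_verts /= -sw take_size_cat// drop_size_cat// -i0.
Qed.

Lemma graft_sub r T : graft r (truncT r T) (sub T) = T.
Proof.
apply: treeP => v /=; rewrite /graft_verts /=; split.
  move=> [[Tv sv]]; move/subE => /(_ Tv) [_].
  by rewrite cat_take_drop.
move=> Tv; have Tt : tverts T (take r.+1 v) by exact: tree_take.
split; last by apply/subE => //; rewrite cat_take_drop.
by split => //; rewrite size_take_min geq_minl.
Qed.

Lemma Dr_truncT r T : Dr r.+1 (truncT r T) = Dr r.+1 T.
Proof. by apply/seteqP; split => v; [move=> [[Tv _] sv]|move=> [Tv sv]; split=> //; split; rewrite ?sv]. Qed.

Lemma tfin_sub r T w : tfin T -> tfin (sub T w).
Proof.
rewrite /sub; case: pselect => [Tw|_] Tfin; rewrite /tfin/=; last first.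
  by rewrite /tree1_verts; apply: (@sub_finite_set _ _ [set` [:: [::]; [:: 0%N]]]);
    [move=> v [] -> /=|].
apply: (@sub_finite_set _ _ ([set [::]] `|`
  [set (0%N :: drop (size w) v) | v in tverts T])).
  move=> [|i u] /=; first by left.
  by move=> [-> H]; right; exists (w ++ u) => //; rewrite drop_size_cat.
by rewrite finite_setU; split => //; apply: finite_image.
Qed.

Lemma tfin_of_sub r T : (forall w, Dr r.+1 T w -> tfin (sub T w)) -> tfin T.
Proof.
move=> fS; apply: (@sub_finite_set _ _ (trunc r.+1 T `|`
  \bigcup_(w in Dr r.+1 T) [set w ++ behead u | u in tverts (sub T w)])).
  move=> v Tv; case: (leqP (size v) r.+1) => sv; [by left|right].
  have Tt : tverts T (take r.+1 v) by exact: tree_take.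
  exists (take r.+1 v); first by split => //; rewrite size_takel// ltnW.
  exists (0%N :: drop r.+1 v); last by rewrite /= cat_take_drop.
  by apply/subE => //; rewrite cat_take_drop.
rewrite finite_setU; split; first exact: finite_trunc.
by apply: bigcup_finite => [|w /fS]; [exact: finite_Dr|exact: finite_image].
Qed.

(** A vertex of height r + 1 sits at height 1 in the branch planted at it, so that heights drop by
    r. *)
Lemma hle_sub r m T : (forall w, Dr r.+1 T w -> hle m.+1 (sub T w)) <-> hle (r + m.+1) T.
Proof.
split=> [H v Tv|hT w [Tw sw] [|i u] // /subE-/(_ Tw)[_ /hT]]; last first.
  by rewrite size_cat sw /=; lia.
case: (leqP r.+1 (size v)) => sv; last by lia.
have Tt : tverts T (take r.+1 v) by exact: tree_take.
have := H (take r.+1 v); have st : size (take r.+1 v) = r.+1 by rewrite size_takel.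
move=> /(_ (conj Tt st)) /(_ (0%N :: drop r.+1 v)).
have Sv : tverts (sub T (take r.+1 v)) (0%N :: drop r.+1 v).
  by apply/subE => //; rewrite cat_take_drop.
by move=> /(_ Sv) /=; rewrite size_drop; lia.
Qed.

(** A vertex above height r lies in exactly one branch, given by its prefix of length r + 1. The
    root of a branch is left out, being a copy of the parent of [w]. *)
Lemma sum_graft r T (phi : seq nat -> nat) : tfin T ->
  (\sum_(v <- vs T | r < size v) phi v =
   \sum_(w <- DrF r.+1 T) \sum_(u <- vs (sub T w) | u != [::]) phi (w ++ behead u))%N.
Proof.
move=> Tfin; transitivity (\sum_(v <- vs T | r < size v)
    \sum_(w <- DrF r.+1 T | w == take r.+1 v) phi v)%N.
  rewrite big_seq_cond [RHS]big_seq_cond; apply: eq_bigr => v /andP[/in_vs-/(_ Tfin) Tv sv].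
  rewrite big_const_seq; set c := count _ _; suff -> : c = 1%N by rewrite /= addn0.
  rewrite /c -[count _ _]/(count_mem (take r.+1 v) (DrF r.+1 T)) count_uniq_mem ?fset_uniq//.
  suff -> : take r.+1 v \in DrF r.+1 T by [].
  by apply/in_DrF; split; [exact: tree_take|rewrite size_takel].
rewrite (exchange_big_dep predT)//=; apply: eq_big_seq => w /in_DrF [Tw sw].
rewrite -big_filter -[RHS]big_filter -(big_map (fun u => w ++ behead u) predT).
have Sfin : tfin (sub T w) by exact: tfin_sub.
apply: perm_big; apply: uniq_perm.
- exact/filter_uniq/fset_uniq.
- rewrite map_inj_in_uniq; first exact/filter_uniq/fset_uniq.
  move=> [|i u] [|j u']; rewrite !mem_filter //= => /in_vs-/(_ Sfin)/tree_head ->.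
  by move=> /in_vs-/(_ Sfin)/tree_head -> /eqP; rewrite eqseq_cat// eqxx => /eqP ->.
- move=> v; rewrite mem_filter; apply/idP/mapP.
    move=> /andP[/andP[sv /eqP wE] /in_vs-/(_ Tfin) Tv].
    exists (0%N :: drop r.+1 v); last by rewrite /= wE cat_take_drop.
    by rewrite mem_filter /=; apply/in_vs => //; apply/subE => //; rewrite wE cat_take_drop.
  move=> [[|i u]]; rewrite mem_filter //= => /in_vs-/(_ Sfin)/subE-/(_ Tw)[_ Twu] ->.
  rewrite -sw take_size_cat// eqxx andbT size_cat sw leq_addr /=.
  exact/in_vs.
Qed.


Lemma size_vs T : tfin T -> size (vs T) = (nedges T).+1.
Proof.
move=> Tfin; rewrite /nedges -/(vs T) prednK//.
rewrite cardfs_gt0; apply/fset0Pn; exists [::].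
by apply/in_vs => //; exact: tree_nil.
Qed.

Lemma nedges_gt0 T : tfin T -> (0 < nedges T)%N.
Proof.
move=> Tfin; rewrite -ltnS -size_vs//.
apply: (@uniq_leq_size _ [:: [::]; [:: 0%N]]) => // v; rewrite !inE => /orP[] /eqP ->; apply/in_vs => //.
  exact: tree_nil.
exact: tree_0.
Qed.

Lemma sum_subN0 T : tfin T -> (\sum_(u <- vs T | u != [::]) 1 = nedges T)%N.
Proof.
move=> Tfin; apply: succn_inj; rewrite -size_vs// -sum1_size.
rewrite [RHS](bigD1_seq [::]) ?fset_uniq//=.
by apply/in_vs => //; exact: tree_nil.
Qed.

Lemma card_DrE r T : tfin T -> (card_Dr r T = \sum_(v <- vs T | size v == r) 1)%N.
Proof.
move=> Tfin; rewrite -big_filter sum1_size.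
apply/perm_size/uniq_perm; [exact: fset_uniq|exact/filter_uniq/fset_uniq|].
move=> v; rewrite mem_filter; apply/idP/andP.
  by move=> /in_DrF[Tv /eqP sv]; split => //; apply/in_vs.
by move=> [/eqP sv /in_vs-/(_ Tfin) Tv]; apply/in_DrF.
Qed.

(** The last edge leading to a top vertex belongs both to the truncation and to the planted branch,
    hence the subtraction. *)
Lemma nedges_graft r T : tfin T ->
  nedges T = (nedges (truncT r T) - card_Dr r.+1 T +
              \sum_(w <- DrF r.+1 T) nedges (sub T w))%N.
Proof.
move=> Tfin; set c := (\sum_(v <- vs T | size v <= r) 1)%N.
have ET : size (vs T) = (c + \sum_(w <- DrF r.+1 T) nedges (sub T w))%N.
  rewrite -sum1_size (bigID (fun v : seq nat => size v <= r)%N)/= -/c; congr (_ + _)%N.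
  under eq_bigl do rewrite -ltnNge.
  rewrite sum_graft//; apply: eq_bigr => w _; rewrite sum_subN0//.
  exact: tfin_sub.
have Et : size (vs (truncT r T)) = (c + card_Dr r.+1 T)%N.
  rewrite -sum1_size (bigID (fun v : seq nat => size v <= r)%N)/=; congr (_ + _)%N.
    rewrite -big_filter /c -[RHS]big_filter; apply/perm_big/uniq_perm.
    - exact/filter_uniq/fset_uniq.
    - exact/filter_uniq/fset_uniq.
    move=> v; rewrite !mem_filter; case: leqP => //= sv.
    by apply/idP/idP => /in_vs H; apply/in_vs => //; [apply H; exact: tfin_truncT|exact: tfin_truncT|split; [exact: H|exact: ltnW]].
  have -> : card_Dr r.+1 T = card_Dr r.+1 (truncT r T) by rewrite /card_Dr Dr_truncT.
  rewrite card_DrE; last exact: tfin_truncT.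
  rewrite big_seq_cond [RHS]big_seq_cond; apply: eq_bigl => v.
  case: (boolP (v \in vs _)) => //= /in_vs-/(_ (tfin_truncT _ _)) [_ sv].
  by rewrite -ltnNge eqn_leq sv.
(* The vertex counts are |T| + 1 and |T0| + 1 = c + K; positivity of c makes the truncated
   subtraction |T0| - K equal to c - 1. *)
have c_gt0 : (0 < c)%N.
  rewrite /c sum1_count -has_count; apply/hasP; exists [::] => //.
  by apply/in_vs => //; exact: tree_nil.
move: ET Et; rewrite !size_vs//; last exact: tfin_truncT.
by move=> *; lia.
Qed.

Lemma card_Dr_le_nedges r T : tfin T -> (card_Dr r.+1 T <= nedges T)%N.
Proof.
move=> Tfin; rewrite card_DrE// -sum_subN0// big_mkcond [leqRHS]big_mkcond.
by apply: leq_sum => -[|i v] _ //=; case: ifP.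
Qed.

Lemma card_Dr_graft r T : tfin T ->
  (card_Dr r.+2 T = \sum_(w <- DrF r.+1 T) card_Dr 2 (sub T w))%N.
Proof.
move=> Tfin; rewrite card_DrE//.
transitivity (\sum_(v <- vs T | r < size v) (size v == r.+2))%N.
  rewrite big_mkcond [RHS]big_mkcond; apply: eq_bigr => v _.
  by case: eqP => [->|_]; rewrite ?ltnSn ?if_same// ltnW.
rewrite sum_graft//; apply: eq_big_seq => w /in_DrF [Tw sw].
rewrite card_DrE; last exact: tfin_sub.
rewrite big_mkcond [RHS]big_mkcond; apply: eq_bigr => -[|i u] _ //=.
by rewrite size_cat sw; case: eqP; case: eqP => //; lia.
Qed.

Fixpoint words (N n : nat) : seq (seq nat) :=
  if n is n'.+1 then [::] :: [seq i :: w | i <- iota 0 N, w <- words N n'] else [:: [::]].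

Lemma in_words N n w : (size w <= n)%N -> all (fun i => i < N)%N w -> w \in words N n.
Proof.
elim: n w => [|n IH] [|i w] //= sw /andP[iN wN].
rewrite inE; apply/orP; right; apply/allpairsP; exists (i, w) => /=; split => //.
  by rewrite mem_iota.
exact: IH.
Qed.

Lemma size_vertex T v : tfin T -> tverts T v -> (size v <= nedges T)%N.
Proof.
move=> Tfin Tv; rewrite -ltnS -size_vs//.
have -> : (size v).+1 = size [seq take i v | i <- iota 0 (size v).+1].
  by rewrite size_map size_iota.
apply: uniq_leq_size.
  rewrite map_inj_in_uniq ?iota_uniq// => i j; rewrite !mem_iota !add0n !ltnS /=.
  by move=> iv jv /(congr1 size); rewrite !size_takel.
by move=> _ /mapP[i _ ->]; apply/in_vs => //; exact: tree_take.
Qed.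

Lemma letter_vertex T v : tfin T -> tverts T v -> all (fun i => i < (nedges T).+1)%N v.
Proof.
move=> Tfin; elim/last_ind: v => [//|v i IH] Tv.
rewrite all_rcons IH ?andbT; last exact: tree_rcons Tv.
rewrite -size_vs//.
have -> : i.+1 = size [seq rcons v j | j <- iota 0 i.+1] by rewrite size_map size_iota.
apply: uniq_leq_size.
  by rewrite map_inj_uniq ?iota_uniq// => j j' /rcons_inj[].
move=> w /mapP[j]; rewrite mem_iota add0n ltnS /= => ji ->; apply/in_vs => //.
exact: tree_sib ji Tv.
Qed.

Lemma hle_nedges T : tfin T -> hle (nedges T) T.
Proof. by move=> Tfin v; apply: size_vertex. Qed.

Lemma vs_inj T T' : tfin T -> tfin T' -> vs T = vs T' -> T = T'.
Proof.
move=> Tf Tf' E; apply: treeP => v.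
by split => /in_vs H; apply/in_vs => //; move: H; rewrite E; apply.
Qed.

(** An address has length at most N because its prefixes are vertices, and letters at most N because
    elder siblings are vertices; so all vertex sets lie in one finite set of words. *)
Lemma finite_trees N : finite_set [set T | tfin T /\ (nedges T <= N)%N].
Proof.
pose W : {fset seq nat} := [fset w in words N.+1 N]%fset.
pose g X := xget tree1 [set T | tfin T /\ vs T = X].
apply: (@sub_finite_set _ _ (g @` [set` fpowerset W])); last exact: finite_image.
move=> T [Tf TN]; exists (vs T).
  rewrite /= fpowersetE; apply/fsubsetP => v /in_vs-/(_ Tf) Tv.
  rewrite !inE; apply: in_words.
    exact: leq_trans (size_vertex Tf Tv) _.
  apply: sub_all (letter_vertex Tf Tv) => i; rewrite !ltnS => iT.
  exact: leq_trans iT _.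
rewrite /g; case: xgetP => [T' _ [Tf' /vs_inj]|/(_ T)]; first exact.
by case; split.
Qed.

End Trees.

(** * Sums over grafted trees, and trees of height at most two *)

Section GraftSum.
Implicit Types (T V : tree) (v w u : seq nat) (r m n i j : nat).

Definition trees_over r V (A : {fset tree}) : set tree :=
  [set T | truncT r T = V /\ forall w, Dr r.+1 V w -> sub T w \in A].

Section Param.
Variables (r : nat) (V : tree) (A : {fset tree}).
Hypothesis hV : hle r.+1 V.
Let D := DrF r.+1 V.

Definition graft_fun (f : {ffun D -> A}) : tree :=
  graft r V (fun w => if insub w is Some w' then val (f w') else tree1).

Lemma sub_graft_fun f (w : D) : sub (graft_fun f) (val w) = val (f w).
Proof.
rewrite /graft_fun sub_graft; first by rewrite valK.
exact/in_DrF/valP.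
Qed.

Lemma graft_fun_inj : injective graft_fun.
Proof.
by move=> f f' ff'; apply/ffunP => w; apply: val_inj; rewrite -!sub_graft_fun ff'.
Qed.

Lemma trees_over_graft_fun : trees_over r V A = range graft_fun.
Proof.
apply/seteqP; split=> [T [TV TA]|_ [f _ <-]]; last first.
  split; first exact: truncT_graft.
  move=> w /in_DrF wD; have -> : w = val (Sub w wD : D) by [].
  by rewrite sub_graft_fun; exact: valP.
have H (w : D) : sub T (val w) \in A by apply: TA; apply/in_DrF; exact: valP.
exists [ffun w => Sub (sub T (val w)) (H w) : A] => //.
rewrite -[RHS](graft_sub r) TV; apply: graft_ext => w /in_DrF wD.
by rewrite insubT /= ffunE.
Qed.

Lemma finite_trees_over : finite_set (trees_over r V A).
Proof. by rewrite trees_over_graft_fun; apply: finite_image. Qed.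

(** Trees over [V] with branches in [A] correspond to functions from the top vertices to [A], so
    that distributivity turns the power into this sum of products. *)
Lemma graft_sum (R : comNzRingType) (F : tree -> R) :
  \sum_(T <- fset_set (trees_over r V A)) \prod_(w <- DrF r.+1 V) F (sub T w) =
  (\sum_(S <- A) F S) ^+ card_Dr r.+1 V.
Proof.
have -> : card_Dr r.+1 V = #|{: D}| by rewrite -cardfE.
transitivity (\prod_(w : D) \sum_(S : A) F (val S)); last first.
  by rewrite prodr_const [in RHS]big_seq_fsetE.
rewrite bigA_distr_bigA /=.
rewrite (perm_big [seq graft_fun f | f <- enum {: {ffun D -> A}}]) /=.
  rewrite big_map big_enum /=; apply: eq_bigr => f _.
  by rewrite big_seq_fsetE /=; apply: eq_bigr => w _; rewrite sub_graft_fun.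
apply: uniq_perm; first exact: fset_uniq.
  by rewrite map_inj_uniq ?enum_uniq//; exact: graft_fun_inj.
move=> T; rewrite in_fset_set; last exact: finite_trees_over.
apply/idP/mapP.
  by move=> /set_mem; rewrite trees_over_graft_fun => -[f _ <-]; exists f => //; rewrite mem_enum.
by move=> [f _ ->]; apply/mem_set; rewrite trees_over_graft_fun; exists f.
Qed.

End Param.

(** These are the trees of height at most 2: the possible truncations at that height, and the
    branches that extend a tree by one generation. *)
Definition star_verts m : set (seq nat) :=
  [set v | match v with
           | [::] => True
           | [:: i] => i = 0%N
           | [:: i; j] => i = 0%N /\ (j < m)%N
           | _ => False end].

Lemma star_ax m : is_tree (star_verts m).
Proof.
split => //=.
- by move=> [|a [|b [|c l]]] i //= [].
- by move=> [|a [|b [|c l]]] i //= [] // -> /ltnW.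
- move=> [|a [|b l]]; [by exists 1%N|by exists m => /= -[_]; rewrite ltnn|].
  by exists 0%N; case: l => [|c l] [].
Qed.
Definition star m := Tree (star_ax m).

Lemma hle_star m : hle 2 (star m).
Proof. by move=> [|a [|b [|c l]]]. Qed.
Lemma tfin_star m : tfin (star m).
Proof. by rewrite -(truncT_id (@hle_star m)); exact: tfin_truncT. Qed.

Lemma vs_star m : perm_eq (vs (star m)) ([::] :: [:: 0%N] :: [seq [:: 0%N; i] | i <- iota 0 m]).
Proof.
apply: uniq_perm; first exact: fset_uniq.
  rewrite /= map_inj_uniq ?iota_uniq ?andbT; last by move=> i j [].
  by rewrite inE /=; apply/andP; split; apply/mapP => -[].
move=> v; apply/idP/idP.
  move=> /in_vs-/(_ (tfin_star m)) /=; case: v => [|a [|b [|c l]]] //=; rewrite ?inE//=.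
    by move=> ->.
  by move=> [-> bm]; apply/mapP; exists b => //; rewrite mem_iota.
rewrite !inE => /or3P[/eqP ->|/eqP ->|/mapP[i + ->]].
- by apply/in_vs => //; exact: tfin_star.
- by apply/in_vs => //; exact: tfin_star.
- by rewrite mem_iota => im; apply/in_vs => //; exact: tfin_star.
Qed.

Lemma nedges_star m : nedges (star m) = m.+1.
Proof.
apply: succn_inj; rewrite -size_vs; last exact: tfin_star.
by rewrite (perm_size (vs_star m)) /= size_map size_iota.
Qed.
Lemma card_Dr_star m : card_Dr 2 (star m) = m.
Proof.
rewrite card_DrE; last exact: tfin_star.
rewrite (perm_big _ (vs_star m)) /= !big_cons /= big_map /=.
by rewrite sum1_size size_iota.
Qed.

Lemma hle2_star T : hle 2 T -> exists m, T = star m.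
Proof.
move=> hT; have [m Tm] := tree_children (tree_0 T); exists m.
apply: treeP => -[|a [|b [|c l]]]; split=> //=.
- by move=> _; exact: tree_nil.
- exact: tree_head.
- by move=> ->; exact: tree_0.
- by move=> H; have a0 := tree_head H; split=> //; apply/Tm; rewrite -a0.
- by move=> [-> /Tm].
- by move/hT.
Qed.

Lemma star_inj : injective star.
Proof. by move=> m m' /(congr1 nedges); rewrite !nedges_star => -[]. Qed.

Lemma hle1_tree1 T : hle 1 T -> T = tree1.
Proof.
move=> hT; apply: treeP => -[|a [|b l]]; split=> //=.
- by left.
- by move=> _; exact: tree_nil.
- by move/tree_head => ->; right.
- by case=> // -[->]; exact: tree_0.
- by move/hT.
- by case.
Qed.

End GraftSum.

(** * Counting trees with a given truncation *)

Lemma big_fset_set_eq (R : nmodType) (I : choiceType) (A B : set I) (p q : pred I)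
    (F : I -> R) : finite_set A -> finite_set B ->
  (forall x, A x /\ p x <-> B x /\ q x) ->
  \sum_(x <- fset_set A | p x) F x = \sum_(x <- fset_set B | q x) F x.
Proof.
move=> fA fB AB; rewrite -big_filter -[RHS]big_filter; apply/perm_big/uniq_perm.
- exact/filter_uniq/fset_uniq.
- exact/filter_uniq/fset_uniq.
move=> x; rewrite !mem_filter !in_fset_set//; apply/andP/andP.
  by move=> [px /set_mem Ax]; have [Bx qx] := (AB x).1 (conj Ax px); split => //; apply/mem_set.
by move=> [px /set_mem Ax]; have [Bx qx] := (AB x).2 (conj Ax px); split => //; apply/mem_set.
Qed.

Lemma height_witness r V : tfin V -> height V = r.+1 -> exists w, Dr r.+1 V w.
Proof.
move=> Vf hV; apply: contrapT => H.
have : (height V <= r)%N.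
  apply/heightP => // v Vv; have := hle_height Vf Vv.
  rewrite hV leq_eqVlt => /orP[/eqP sv|//].
  by case: H; exists v.
by rewrite hV ltnn.
Qed.

Section Counting.
Variables (R : realType) (c : R).
Hypothesis c_gt0 : 0 < c.
Implicit Types (T V : tree) (r m n N K : nat).

Definition treesF N := fset_set (treesN N).

Lemma finite_treesN N : finite_set (treesN N).
Proof. by apply: sub_finite_set (finite_trees N) => T [? <-]. Qed.

Lemma in_treesF N T : (T \in treesF N) <-> tfin T /\ nedges T = N.
Proof.
by rewrite /treesF in_fset_set; [split => [/set_mem|/mem_set]|exact: finite_treesN].
Qed.

Definition gfX : fps R := Fps (fun n => \sum_(T <- treesF n) c ^+ n).
Definition gfXm m : fps R := Fps (fun n => \sum_(T <- treesF n | (height T <= m)%N) c ^+ n).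
Let g := fpsC c * fpsX R.

Let coef_gX n i : (g ^+ n) i = if n == i then c ^+ i else 0.
Proof.
rewrite /g exprMn -fpsCX fpsCME -[fpsX R ^+ n]mulr1 fpsXnME fps1E.
case: ltngtP => [ni|ni|->]; rewrite ?mulr0 ?subnn ?mulr1//.
by rewrite subn_eq0 leqNgt ni mulr0.
Qed.

(** A finite stock of branches, as required by [graft_sum]; branches with at most N edges suffice
    for the coefficients up to degree N. *)
Let A N m := fset_set [set T | tfin T /\ (nedges T <= N)%N /\ hle m T].

Let finA N m : finite_set [set T | tfin T /\ (nedges T <= N)%N /\ hle m T].
Proof. by apply: sub_finite_set (finite_trees N) => T [? []]. Qed.

Let in_A N m T : (T \in A N m) <-> [/\ tfin T, (nedges T <= N)%N & hle m T].
Proof.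
rewrite /A in_fset_set//; split => [/set_mem[? []]//|[? ? ?]].
exact/mem_set.
Qed.

Let sum_A N m : eqfps N (\sum_(T <- A N m) g ^+ nedges T) (gfXm m).
Proof.
move=> n nN; rewrite fps_sumE /=.
under eq_bigr do rewrite coef_gX.
rewrite -big_mkcond /=; apply: big_fset_set_eq => //; first exact: finite_treesN.
move=> T; split=> [[[Tf [_ hT]] /eqP Tn]|[[Tf Tn] /heightP-/(_ Tf) hT]].
  by split=> //; apply/heightP.
by split; [split=> //; split=> //; rewrite Tn|rewrite Tn].
Qed.

Let hgt_gt0 T : tfin T -> (0 < height T)%N.
Proof.
by move=> Tf; exact: (hle_height Tf (tree_0 T)).
Qed.

Lemma gfXm_0 : gfXm 0 = 0.
Proof.
apply: fpsP => n /=; rewrite big_seq_cond big1// => T /andP[/in_treesF[Tf _]].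
by rewrite leqNgt hgt_gt0.
Qed.

Lemma gfXm_ge0 m : nneg_fps (gfXm m).
Proof. by move=> n; apply: sumr_ge0 => T _; rewrite exprn_ge0// ltW. Qed.

Lemma gfXm_lim m : eqfps m (gfXm m) gfX.
Proof.
move=> n nm /=; rewrite big_seq_cond [RHS]big_seq_cond; apply: eq_bigl => T.
rewrite andbT; case: (boolP (T \in _)) => //= /in_treesF[Tf Tn].
by apply/heightP => // v Tv; apply: leq_trans (size_vertex Tf Tv) _; rewrite Tn.
Qed.

Lemma gfX_sub_ge0 m : nneg_fps (gfX - gfXm m).
Proof.
move=> n; rewrite fpsBE /= (bigID (fun T => height T <= m)%N) /= addrC addrK.
by apply: sumr_ge0 => T _; rewrite exprn_ge0// ltW.
Qed.

Lemma ball_count r m N V : hle r.+1 V ->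
  \sum_(T <- treesF N | (truncT r T == V) && (height T <= r + m.+1)%N) c ^+ N =
  (g ^+ (nedges V - card_Dr r.+1 V) * gfXm m.+1 ^+ card_Dr r.+1 V) N.
Proof.
move=> hV; have := @graft_sum r V (A N m.+1) hV (fps R) (fun S => g ^+ nedges S).
set d := (_ - _)%N; move/(congr1 (fun b => (g ^+ d * b) N)).
rewrite (eqfpsM (@eqfps_refl _ N (g ^+ d)) (@eqfpsX _ N _ _ _ (@sum_A N m.+1)) (leqnn N)) => <-.
have fin_over T : trees_over r V (A N m.+1) T -> tfin T.
  move=> [TV TA]; apply: (@tfin_of_sub r) => w.
  by rewrite -Dr_truncT TV => /TA /in_A[].
have over_nedges T : tfin T -> truncT r T = V ->
    (nedges T = d + \sum_(w <- DrF r.+1 V) nedges (sub T w))%N.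
  move=> Tf TV; rewrite (nedges_graft r Tf) TV /d.
  by rewrite /card_Dr /DrF -(Dr_truncT r T) TV.
rewrite mulr_sumr fps_sumE; symmetry.
transitivity (\sum_(T <- fset_set (trees_over r V (A N m.+1)) | nedges T == N) c ^+ N).
  rewrite [RHS]big_mkcond big_seq [RHS]big_seq; apply: eq_bigr => T.
  rewrite in_fset_set; last exact: finite_trees_over.
  move=> /set_mem oT; have [TV _] := oT; have Tf := fin_over _ oT.
  by rewrite prodrXr -exprD -over_nedges// coef_gX.
apply: big_fset_set_eq; [exact: finite_trees_over|exact: finite_treesN|].
move=> T; split.
  move=> [oT /eqP Tn]; have Tf := fin_over _ oT; have [TV TA] := oT.
  split=> //; rewrite TV eqxx /=; apply/heightP => //; apply/hle_sub => w.
  by rewrite -Dr_truncT TV => /TA /in_A[].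
move=> [[Tf Tn] /andP[/eqP TV /heightP-/(_ Tf)/hle_sub hT]].
split; last by rewrite Tn.
split=> // w Vw; apply/in_A; split; first exact: tfin_sub.
  rewrite -Tn (over_nedges _ Tf TV) (bigD1_seq w) ?fset_uniq//=; last first.
    by have := (in_DrF r.+1 V w).2 Vw.
  by rewrite addnCA leq_addr.
by apply: hT; rewrite -Dr_truncT TV.
Qed.

Lemma gfXm_at0 m : gfXm m 0 = 0.
Proof.
rewrite /= big_seq_cond big1// => T /andP[/in_treesF[Tf T0] _].
by have := nedges_gt0 Tf; rewrite T0.
Qed.

Lemma tree1_star : tree1 = star 0.
Proof. by symmetry; apply: hle1_tree1 => -[|a [|b [|d l]]] // []. Qed.

(** Decomposition at the first branching: j children contribute X_m^j, and summing over j gives g /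
    (1 - X_m). *)
Lemma gfXm_rec m : gfXm m.+1 = g + gfXm m * gfXm m.+1.
Proof.
case: m => [|m].
  rewrite gfXm_0 mul0r addr0; apply: fpsP => n.
  rewrite -[g]expr1 coef_gX /=.
  have t1f : tfin tree1 by rewrite tree1_star; exact: tfin_star.
  have t1e : nedges tree1 = 1%N by rewrite tree1_star nedges_star.
  transitivity (\sum_(T <- fset_set [set tree1] | nedges T == n) c ^+ n).
    apply: big_fset_set_eq => //; first exact: finite_treesN.
    move=> T; split=> [[[Tf Tn] /heightP-/(_ Tf)/hle1_tree1 T1]|[-> /eqP Tn]].
      by split=> //; rewrite Tn.
    split=> //; apply/heightP => //; rewrite -t1e; exact: hle_nedges.
  by rewrite fset_set1 big_mkcond big_seq_fset1 t1e.
apply: fpsP => n.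
have E : eqfps n (gfXm m.+2) (g * \sum_(j < n.+1) gfXm m.+1 ^+ j).
  move=> i i_n; rewrite mulr_sumr fps_sumE.
  have -> : gfXm m.+2 i = \sum_(j < n.+1) \sum_(T <- treesF i |
     (truncT 1 T == star j) && (height T <= 1 + m.+1)%N) c ^+ i.
    rewrite (exchange_big_dep (fun T => height T <= m.+2)%N) /=; last first.
      by move=> j T _ /andP[].
    rewrite /= big_seq_cond [RHS]big_seq_cond; apply: eq_bigr => T.
    move=> /andP[/in_treesF[Tf Ti] hT].
    have [j Tj] := hle2_star (@hle_truncT 1 T).
    have j_n : (j < n.+1)%N.
      have := card_Dr_le_nedges 1 Tf; have -> : card_Dr 2 T = j.
        by rewrite -(card_Dr_star j) -Tj /card_Dr Dr_truncT.
      by rewrite Ti ltnS => /leq_trans; apply.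
    rewrite (big_pred1 (Ordinal j_n)) // => l /=.
    rewrite add1n hT andbT Tj; apply/eqP/eqP => [/star_inj jl|->//].
    exact: val_inj.
  apply: eq_bigr => j _; rewrite ball_count; last exact: hle_star.
  by rewrite card_Dr_star nedges_star subSnn expr1.
(* The finite geometric sum leaves g (1 - X_(m+1)^(n+1)), and the power has no coefficient of degree
   at most n. *)
have : ((1 - gfXm m.+1) * gfXm m.+2) n = g n.
  rewrite (eqfpsM (@eqfps_refl _ n (1 - gfXm m.+1)) E (leqnn n)).
  have -> : (1 - gfXm m.+1) * (g * \sum_(j < n.+1) gfXm m.+1 ^+ j) =
    g * - ((gfXm m.+1 - 1) * \sum_(j < n.+1) gfXm m.+1 ^+ j) by ring.
  rewrite -subrX1 opprB -[in RHS](mulr1 g).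
  apply: (eqfpsM (@eqfps_refl _ n g) _ (leqnn n)) => i i_n.
  by rewrite fpsBE fpsX_low ?subr0//; exact: gfXm_at0.
by rewrite mulrBl mul1r fpsBE fpsDE => <-; rewrite subrK.
Qed.

Variables (k : R).

Definition fps_W K : fps R := gfX ^+ K + fpsC (k - 1) *
  fps_lsum (fun m => fpsC (k ^+ m) * (gfX ^+ K - gfXm m ^+ K)).

(** Summation by layers: k^h becomes a combination of indicators of m < h, each of which is a count
    of trees with a height condition. The common bound [M] allows the sums over m and over trees to
    be exchanged. *)
Let geom h M : (h <= M)%N ->
  k ^+ h = 1 + (k - 1) * \sum_(m < M) k ^+ m * (m < h)%N%:R.
Proof.
move=> hM; have -> : \sum_(m < M) k ^+ m * (m < h)%N%:R = \sum_(m < h) k ^+ m.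
  rewrite (big_ord_widen M (fun m => k ^+ m))// [RHS]big_mkcond.
  by apply: eq_bigr => m _; case: ifP; rewrite ?mulr1 ?mulr0.
by rewrite -subrX1 addrC subrK.
Qed.

Lemma ball_weight r V N : tfin V -> height V = r.+1 ->
  c ^+ N * \sum_(T <- treesF N | truncT r T == V) k ^+ height T =
  k ^+ r * (g ^+ (nedges V - card_Dr r.+1 V) * fps_W (card_Dr r.+1 V)) N.
Proof.
move=> Vf hVr; have hV : hle r.+1 V by rewrite -hVr; exact: hle_height.
set K := card_Dr r.+1 V; set d := (_ - _)%N.
have [w Vw] := height_witness Vf hVr.
have K_gt0 : (0 < K)%N.
  by rewrite cardfs_gt0; apply/fset0Pn; exists w; apply/in_DrF.
have hgtr T : tfin T -> truncT r T = V -> (r < height T)%N.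
  move=> Tf TV; case: Vw => Vw <-; apply: hle_height => //.
  by move: Vw; rewrite -TV => -[].
have hgtN T : T \in treesF N -> (height T <= N)%N.
  by move=> /in_treesF[Tf <-]; apply/heightP => //; exact: hle_nedges.
have cnt m : \sum_(T <- treesF N | (truncT r T == V) && (height T <= r + m)%N) c ^+ N =
    (g ^+ d * gfXm m ^+ K) N.
  (* No tree over [V] has height at most r, and the other side vanishes since X_0 = 0 and K is
     positive. *)
  case: m => [|m]; last exact: ball_count.
  rewrite gfXm_0 expr0n gtn_eqF// mulr0 big_seq_cond big1//.
  move=> T /and3P[/in_treesF[Tf _] /eqP /hgtr-/(_ Tf)].
  by rewrite addn0 ltnNge => /negbTE ->.
have cntT : \sum_(T <- treesF N | truncT r T == V) c ^+ N = (g ^+ d * gfX ^+ K) N.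
  have E := @eqfpsX _ N _ _ K (@gfXm_lim N).
  rewrite -(eqfpsM (@eqfps_refl _ N (g ^+ d)) E (leqnn N)) -cnt.
  rewrite big_seq_cond [RHS]big_seq_cond; apply: eq_bigl => T.
  case: (boolP (T \in treesF N)) => //= /hgtN hT.
  by case: eqP => //= _; rewrite (leq_trans hT)// leq_addl.
have cntC m : \sum_(T <- treesF N | truncT r T == V) c ^+ N * (m < height T - r)%N%:R =
    (g ^+ d * (gfX ^+ K - gfXm m ^+ K)) N.
  rewrite mulrBr fpsBE -cntT -cnt.
  rewrite [X in X - _](bigID (fun T => height T <= r + m)%N) /= addrC addrK.
  rewrite big_mkcond [RHS]big_mkcond; apply: eq_bigr => T _.
  by rewrite -ltnNge ltn_subRL; case: eqP => //= _; case: ifP; rewrite ?mulr1 ?mulr0.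
rewrite /fps_W mulrDr fpsDE -cntT.
have -> : g ^+ d * (fpsC (k - 1) * fps_lsum (fun m => fpsC (k ^+ m) * (gfX ^+ K - gfXm m ^+ K)))
  = fpsC (k - 1) * (g ^+ d * fps_lsum (fun m => fpsC (k ^+ m) * (gfX ^+ K - gfXm m ^+ K))) by ring.
rewrite fpsCME.
have low m : eqfps m (fpsC (k ^+ m) * (gfX ^+ K - gfXm m ^+ K)) 0.
  move=> n nm; rewrite fpsCME fpsBE (@eqfpsX _ m _ _ K (@gfXm_lim m) n nm).
  by rewrite subrr mulr0.
rewrite -(eqfpsM (@eqfps_refl _ N (g ^+ d)) (@eqfps_lsum _ _ N low) (leqnn N)).
have -> : (g ^+ d * \sum_(m < N) fpsC (k ^+ m) * (gfX ^+ K - gfXm m ^+ K)) N =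
    \sum_(T <- treesF N | truncT r T == V)
      \sum_(m < N) k ^+ m * (c ^+ N * (m < height T - r)%N%:R).
  rewrite mulr_sumr fps_sumE [RHS]exchange_big; apply: eq_bigr => m _.
  by rewrite mulrCA fpsCME -cntC mulr_sumr.
rewrite [LHS]mulr_sumr [X in _ = _ * (_ + X)]mulr_sumr -big_split /= [RHS]mulr_sumr.
rewrite big_seq_cond [RHS]big_seq_cond; apply: eq_bigr => T /andP[TN /eqP TV].
have [Tf _] := (in_treesF N T).1 TN.
have hr := hgtr _ Tf TV; have -> : height T = (r + (height T - r))%N by rewrite subnKC// ltnW.
rewrite exprD (@geom (height T - r)%N N); last first.
  exact: leq_trans (leq_subr _ _) (hgtN _ TN).
rewrite addKn.
have -> : \sum_(m < N) k ^+ m * (c ^+ N * (m < height T - r)%N%:R) =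
  c ^+ N * \sum_(m < N) k ^+ m * (m < height T - r)%N%:R.
  by rewrite mulr_sumr; apply: eq_bigr => m _; ring.
by ring.
Qed.

End Counting.

(** * Limits of the probabilities of balls *)

Section BallLimit.
Variables (R : realType) (mu : R).
Hypothesis hmu : mu < 0.
Implicit Types (T V : tree) (r m n N K : nat).

Let k := expR (- mu).
Let gc := k / (1 + k) ^+ 2.
Let Y := (1 + k)^-1.

Let k1 : 1 < k. Proof. by rewrite expR_gt1 oppr_gt0. Qed.
Let k0 : 0 < k. Proof. exact: expR_gt0. Qed.
Let gc0 : 0 < gc. Proof. by rewrite divr_gt0// exprn_gt0// addr_gt0. Qed.

Lemma half_sqrt_gc : (1 - Num.sqrt (1 - 4 * gc)) / 2 = Y.
Proof.
have -> : 1 - 4 * gc = ((k - 1) / (1 + k)) ^+ 2.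
  by rewrite /gc; field; have := k0; lra.
rewrite sqrtr_sqr ger0_norm; last first.
  by rewrite divr_ge0 ?subr_ge0 ?addr_ge0// ltW.
by rewrite /Y; field; have := k0; lra.
Qed.

(* The claimed probability of the ball around [V] of radius [1 / (r + 1)]; it is
   null on trees of smaller height, since the limit tree is infinite. *)
Definition tree_mass r V : R :=
  if height V == r.+1 then
    (card_Dr r.+1 V)%:R * k ^+ r * gc ^+ (nedges V - card_Dr r.+1 V) *
      Y ^+ (card_Dr r.+1 V - 1)
  else 0.

Lemma tree_mass_ge0 r V : 0 <= tree_mass r V.
Proof.
rewrite /tree_mass; case: ifP => // _.
by rewrite !mulr_ge0 ?ler0n ?exprn_ge0 ?invr_ge0 ?addr_ge0 ?ltW.
Qed.

Lemma expR_height T : expR (- mu * (height T)%:R) = k ^+ height T.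
Proof. by rewrite mulrC expRM_natl. Qed.

Lemma ZNE N : ZN mu N = \sum_(T <- treesF N) k ^+ height T.
Proof.
rewrite /ZN fsbig_finite; last exact: finite_treesN.
by apply: eq_bigr => T _; rewrite expR_height.
Qed.

Lemma EnuNE N f : EnuN mu N f = \sum_(T <- treesF N) f T * nuN mu N T.
Proof. by rewrite /EnuN fsbig_finite//; exact: finite_treesN. Qed.

Lemma nuN_ge0 N T : 0 <= nuN mu N T.
Proof.
rewrite /nuN divr_ge0 ?expR_ge0// ZNE; apply: sumr_ge0 => T' _.
by rewrite exprn_ge0// ltW.
Qed.

Definition probN N (P : pred tree) : R := \sum_(T <- treesF N | P T) nuN mu N T.

Lemma height_tree1 : height tree1 = 1%N.
Proof.
have t1f : tfin tree1 by rewrite tree1_star; exact: tfin_star.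
apply/eqP; rewrite eqn_leq; apply/andP; split.
  by apply/heightP => // v [] ->.
by exact: (hle_height t1f (tree_0 tree1)).
Qed.

Lemma card_Dr_tree1 : card_Dr 1 tree1 = 1%N.
Proof.
rewrite tree1_star card_DrE; last exact: tfin_star.
by rewrite (perm_big _ (vs_star 0)) /= !big_cons big_nil.
Qed.

Lemma truncT_tree1 T : truncT 0 T = tree1.
Proof. exact/hle1_tree1/hle_truncT. Qed.

Let tree1_fin : tfin tree1.
Proof. by rewrite tree1_star; exact: tfin_star. Qed.

Lemma tree_mass1 : tree_mass 0 tree1 = 1.
Proof.
by rewrite /tree_mass height_tree1 eqxx card_Dr_tree1 tree1_star nedges_star !expr0 !mulr1.
Qed.

(** The ball around [tree1] is the whole space, so the partition function is itself a ball weight,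
    with K = 1. *)
Lemma gcZN N : gc ^+ N * ZN mu N = fps_W gc k 1 N.
Proof.
have := ball_weight gc k N tree1_fin height_tree1.
rewrite card_Dr_tree1 tree1_star nedges_star !expr0 !mul1r => <-.
rewrite ZNE; congr (_ * _); apply: eq_bigl => T.
by rewrite -tree1_star truncT_tree1 eqxx.
Qed.

Lemma ball_limit_full r V : tfin V -> height V = r.+1 ->
  probN N (fun T => truncT r T == V) @[N --> \oo] --> tree_mass r V.
Proof.
move=> Vf hV.
have [s s0 sK] := fps_tail_sum_cvg k1 (gfXm_0 gc) (gfXm_rec gc) (gfXm_ge0 gc0)
  (@gfXm_lim R gc) (gfX_sub_ge0 gc0).
set K := card_Dr r.+1 V; set d := (nedges V - K)%N.
have E N : probN N (fun T => truncT r T == V) =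
    k ^+ r * (fpsC gc ^+ d * fpsX R ^+ d * fps_W gc k K) N / fps_W gc k 1 N.
  rewrite -exprMn -(ball_weight gc k N Vf hV) -gcZN.
  have gN : gc ^+ N != 0 by rewrite expf_neq0// gt_eqF.
  rewrite /probN -mulf_div divff// mul1r mulr_suml.
  by apply: eq_bigr => T _; rewrite /nuN expR_height.
have -> : tree_mass r V = k ^+ r * (gc ^+ d * (K%:R * Y ^+ (K - 1) * s)) / s.
  by rewrite /tree_mass hV eqxx -/K -/d; field; rewrite gt_eqF.
under eq_fun do rewrite E.
apply: cvgM; last first.
  apply: cvgV; first by rewrite gt_eqF.
  have := sK 1%N; rewrite subnn expr0 mulr1 mul1r; exact.
apply: cvgM; first exact: cvg_cst.
(* The factor t^d only delays the coefficients by d. *)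
rewrite -(cvg_shiftn d).
have -> : (fun n => (fpsC gc ^+ d * fpsX R ^+ d * fps_W gc k K) (n + d)%N) =
    (fun n => gc ^+ d * fps_W gc k K n).
  apply: funext => n; rewrite -fpsCX -mulrA fpsCME fpsXnME leq_addl addnK//.
by apply: cvgM; [exact: cvg_cst|exact: sK].
Qed.

Lemma truncT_low r T V : hle r V -> truncT r T = V -> T = V.
Proof.
move=> hV TV; rewrite -TV truncT_id// => v Tv; rewrite leqNgt; apply/negP => sv.
have : tverts V (take r.+1 v).
  rewrite -TV; split; first exact: tree_take.
  by rewrite size_take_min geq_minl.
by move=> /hV; rewrite size_takel ?ltnn// ltnW.
Qed.

(** If [V] is lower than r + 1, then only [V] itself truncates to [V], and it has fewer than N edges
    once N is large. *)
Lemma ball_limit r V : tfin V -> hle r.+1 V ->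
  probN N (fun T => truncT r T == V) @[N --> \oo] --> tree_mass r V.
Proof.
move=> Vf hV; case: (eqVneq (height V) r.+1) => [E|hE]; first exact: ball_limit_full.
rewrite /tree_mass (negbTE hE).
have hV' : hle r V.
  apply/heightP => //; have /heightP-/(_ Vf) := hV.
  by rewrite leq_eqVlt (negbTE hE).
apply: cvg_near_cst; near=> N.
rewrite /probN big_seq_cond big1// => T /andP[/in_treesF[Tf TN] /eqP /truncT_low E].
have NV : (nedges V < N)%N by near: N; exact: nbhs_infty_gt.
by move: NV; rewrite -TN E// ltnn.
Unshelve. all: by end_near. Qed.

Lemma probN_total : probN N predT @[N --> \oo] --> (1 : R).
Proof.
rewrite -tree_mass1; have := ball_limit_full tree1_fin height_tree1.
have -> : (fun N => probN N (fun T => truncT 0 T == tree1)) = (fun N => probN N predT).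
  by apply: funext => N; apply: eq_bigl => T; rewrite truncT_tree1 eqxx.
exact.
Qed.

End BallLimit.

(** * Consistency of the ball masses *)

Lemma fpsexp_coef0 (R : comNzRingType) (a : fps R) n : (a ^+ n) 0%N = a 0%N ^+ n.
Proof.
elim: n => [//|n IH]; rewrite exprS fpsME big_ord_recl big_ord0 addr0 /= subn0 IH.
by rewrite exprS.
Qed.

Lemma fpsexp_coef1 (R : comNzRingType) (a : fps R) n :
  (a ^+ n) 1%N = n%:R * a 0%N ^+ (n - 1) * a 1%N.
Proof.
elim: n => [|n IH]; first by rewrite !mul0r.
rewrite exprS fpsME !big_ord_recl big_ord0 addr0 /= subn0 subnn IH fpsexp_coef0.
rewrite subn1 /= -natr1; case: n {IH} => [|n]; first by rewrite expr0; ring.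
by rewrite subn1 /= exprS; ring.
Qed.

Lemma ler_sum_subseq (R : numDomainType) (I : eqType) (s s' : seq I) (F : I -> R) :
  uniq s -> uniq s' -> {subset s <= s'} -> (forall i, 0 <= F i) ->
  \sum_(i <- s) F i <= \sum_(i <- s') F i.
Proof.
move=> us us' ss' F0; rewrite [leRHS](bigID (mem s)) /= -[leLHS]addr0.
apply: lerD; last exact: sumr_ge0.
rewrite -[in leRHS]big_filter le_eqVlt; apply/orP; left; apply/eqP.
apply/perm_big/uniq_perm => //; first exact: filter_uniq.
by move=> i; rewrite mem_filter /=; case: (boolP (i \in s)) => //= /ss' ->.
Qed.

Section Mass.
Variables (R : realType) (mu : R).
Hypothesis hmu : mu < 0.
Implicit Types (T V : tree) (r m n N K M : nat).

Let k := expR (- mu).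
Let gc := k / (1 + k) ^+ 2.
Let Y := (1 + k)^-1.

Let k1 : 1 < k. Proof. by rewrite expR_gt1 oppr_gt0. Qed.
Let k0 : 0 < k. Proof. exact: expR_gt0. Qed.
Let Y0 : 0 < Y. Proof. by rewrite invr_gt0 addr_gt0. Qed.
Let Y1 : Y < 1. Proof. by rewrite invf_lt1 ?addr_gt0// ltrDl. Qed.

(** The bound on the number of children keeps the family of one-generation extensions finite; [M]
    tends to infinity in [mass_sum_cvg]. *)
Definition stars M : {fset tree} := [fset star j | j in iota 0 M]%fset.

Lemma in_stars M T : T \in stars M <-> exists2 j, (j < M)%N & T = star j.
Proof.
split=> [/imfsetP[j /=]|[j jM ->]]; first by rewrite mem_iota => jM ->; exists j.
by apply/imfsetP; exists j => //=; rewrite mem_iota.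
Qed.

Lemma card_Dr_eq0 r V : tfin V -> (height V < r)%N -> card_Dr r V = 0%N.
Proof.
move=> Vf hV; apply/eqP; rewrite cardfs_eq0; apply/eqP/fsetP => w; rewrite in_fset0.
apply/negbTE/negP => /in_DrF [Vw sw]; have := hle_height Vf Vw.
by rewrite sw leqNgt hV.
Qed.

Lemma tree_mass_gt0 r V : tfin V -> height V = r.+1 -> 0 < tree_mass mu r V.
Proof.
move=> Vf hV; rewrite /tree_mass hV eqxx.
have [w Vw] := height_witness Vf hV.
have K_gt0 : (0 < card_Dr r.+1 V)%N.
  by rewrite cardfs_gt0; apply/fset0Pn; exists w; apply/in_DrF.
have gc0 : 0 < gc by rewrite divr_gt0// exprn_gt0// addr_gt0.
by rewrite !mulr_gt0 ?ltr0n ?exprn_gt0.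
Qed.

(** On a tree lower than r + 1 the factor K = 0 already makes the formula vanish, so that one
    expression covers both cases. *)
Lemma tree_massE r V : tfin V -> hle r.+1 V ->
  tree_mass mu r V = (card_Dr r.+1 V)%:R * k ^+ r *
    gc ^+ (nedges V - card_Dr r.+1 V) * Y ^+ (card_Dr r.+1 V - 1).
Proof.
move=> Vf hV; rewrite /tree_mass; case: eqP => // /eqP hE.
rewrite card_Dr_eq0 ?mul0r//; have /heightP-/(_ Vf) := hV.
by rewrite leq_eqVlt (negbTE hE).
Qed.

Lemma trees_over_stars r V M T : hle r.+1 V -> trees_over r V (stars M) T ->
  [/\ tfin T, hle r.+2 T &
      (nedges T - card_Dr r.+2 T = nedges V)%N].
Proof.
move=> hV [TV TA].
have subS w : Dr r.+1 T w -> exists2 j, (j < M)%N & sub T w = star j.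
  by rewrite -Dr_truncT TV => /TA/in_stars.
have Tf : tfin T.
  by apply: (@tfin_of_sub r) => w /subS [j _ ->]; exact: tfin_star.
split=> //.
  rewrite -addn2; apply/hle_sub => w /subS [j _ ->]; exact: hle_star.
have Vf : tfin V by rewrite -TV; exact: tfin_truncT.
rewrite (card_Dr_graft r Tf) (nedges_graft r Tf) TV.
have -> : (\sum_(w <- DrF r.+1 T) nedges (sub T w) =
   card_Dr r.+1 V + \sum_(w <- DrF r.+1 T) card_Dr 2 (sub T w))%N.
  have -> : card_Dr r.+1 V = (\sum_(w <- DrF r.+1 T) 1)%N.
    by rewrite sum1_size -TV /card_Dr Dr_truncT.
  rewrite -big_split; apply: eq_big_seq => w /in_DrF /subS [j _ ->].
  by rewrite nedges_star card_Dr_star.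
have -> : card_Dr r.+1 T = card_Dr r.+1 V by rewrite -TV /card_Dr Dr_truncT.
by rewrite addnA addnK subnK// card_Dr_le_nedges.
Qed.

Definition mass_sum r V M : R :=
  \sum_(T <- fset_set (trees_over r V (stars M))) tree_mass mu r.+1 T.

Let s0 M : R := \sum_(j < M) Y ^+ j.
Let s1 M : R := \sum_(j < M) j%:R * Y ^+ (j - 1).

Lemma mass_sumE r V M : tfin V -> hle r.+1 V ->
  mass_sum r V M = k ^+ r.+1 * gc ^+ nedges V *
    ((card_Dr r.+1 V)%:R * s0 M ^+ (card_Dr r.+1 V - 1) * s1 M).
Proof.
(* The weight [n * Y ^+ (n - 1)] is not multiplicative in [n], but it is the
   coefficient of degree 1 of [(Y + t) ^+ n], which is. *)
move=> Vf hV; pose b := fpsC Y + fpsX R.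
have b0 : b 0%N = Y by rewrite fpsDE /= addr0.
have b1 : b 1%N = 1 by rewrite fpsDE /= add0r.
have bn n : (b ^+ n) 1%N = n%:R * Y ^+ (n - 1) by rewrite fpsexp_coef1 b0 b1 mulr1.
have := @graft_sum r V (stars M) hV (fps R) (fun S => b ^+ card_Dr 2 S).
have -> : \sum_(S <- stars M) b ^+ card_Dr 2 S = \sum_(j < M) b ^+ j.
  rewrite big_imfset /=; last by move=> i j _ _; exact: star_inj.
  rewrite -(big_mkord predT (fun j => b ^+ j)) /index_iota subn0.
  rewrite undup_id ?iota_uniq//; apply: eq_bigr => j _; by rewrite card_Dr_star.
move/(congr1 (fun a : fps R => a 1%N)).
rewrite fpsexp_coef1 !fps_sumE.
have -> : \sum_(j < M) (b ^+ j) 0%N = s0 M.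
  by apply: eq_bigr => j _; rewrite fpsexp_coef0 b0.
have -> : \sum_(j < M) (b ^+ j) 1%N = s1 M by apply: eq_bigr => j _; rewrite bn.
move=> <-; rewrite mulr_sumr; apply: eq_big_seq => T.
rewrite in_fset_set; last exact: finite_trees_over.
move=> /set_mem oT; have [Tf hT Te] := trees_over_stars hV oT.
rewrite tree_massE// Te prodrXr.
have -> : (\sum_(w <- DrF r.+1 V) card_Dr 2 (sub T w))%N = card_Dr r.+2 T.
  by rewrite (card_Dr_graft r Tf) -(proj1 oT) /DrF Dr_truncT.
by rewrite bn; ring.
Qed.

Let s0_cvg : s0 M @[M --> \oo] --> (1 - Y)^-1.
Proof.
have := @cvg_geometric_series R 1 Y; rewrite ger0_norm ?(ltW Y0)// mul1r => /(_ Y1).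
have -> : series (geometric 1 Y) = s0.
  by apply: funext => M; rewrite /series/= big_mkord; apply: eq_bigr => j _; rewrite mul1r.
exact.
Qed.

Let s1E M : (1 - Y) * s1 M = s0 M - M%:R * Y ^+ (M - 1).
Proof.
elim: M => [|M IH]; first by rewrite /s1 /s0 !big_ord0 mul0r mulr0 subrr.
rewrite /s1 /s0 !big_ord_recr /= -/(s1 M) -/(s0 M) mulrDr IH subn1 /=.
case: M {IH} => [|M]; first by rewrite expr0; ring.
by rewrite subn1 /= exprS -!natr1; ring.
Qed.

(** By [s1E] the increasing sums s1 are bounded, hence convergent. The boundary term in [s1E] is the
    general term of that same series, so it tends to 0. *)
Let s1_cvg : s1 M @[M --> \oo] --> (1 - Y)^-2.
Proof.
pose u j : R := j%:R * Y ^+ (j - 1).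
have u0 j : 0 <= u j by rewrite mulr_ge0 ?ler0n ?exprn_ge0 ?(ltW Y0).
have s1u : s1 = series u by apply: funext => M; rewrite /series/= big_mkord.
have Y1' : 0 < 1 - Y by rewrite subr_gt0.
have s0le M : s0 M <= (1 - Y)^-1.
  rewrite -(cvg_lim (@Rhausdorff R) s0_cvg); apply: nondecreasing_cvgn_le; last first.
    by apply/cvg_ex; exists (1 - Y)^-1.
  have -> : s0 = series (fun j => Y ^+ j) by apply: funext => i; rewrite /series/= big_mkord.
  by apply: nondecreasing_series => i _ _; rewrite exprn_ge0// ltW.
have cu : cvgn (series u).
  apply: nondecreasing_is_cvgn; first by apply: nondecreasing_series => i _ _.
  exists ((1 - Y)^-1 / (1 - Y)) => _ [M _ <-]; rewrite -s1u ler_pdivlMr// mulrC s1E.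
  by apply: le_trans (s0le M); rewrite gerBl; exact: u0.
have u_0 : u M @[M --> \oo] --> (0 : R) by exact: cvg_series_cvg_0.
have -> : s1 = fun M => (s0 M - u M) / (1 - Y).
  by apply: funext => M; rewrite -s1E mulrC mulKf// gt_eqF.
have -> : (1 - Y)^-2 = ((1 - Y)^-1 - 0) / (1 - Y) by rewrite subr0 expr2 invfM.
by apply: cvgM; [exact: cvgB|exact: cvg_cst].
Qed.

(** The relations gc = Y (1 - Y) and 1 - Y = k Y turn k^(r+1) gc^K (1 - Y)^-(K+1), which arises in
    the limit of [mass_sumE], into k^r Y^(K-1). *)
Lemma mass_sum_cvg r V : tfin V -> hle r.+1 V ->
  mass_sum r V M @[M --> \oo] --> tree_mass mu r V.
Proof.
move=> Vf hV; set K := card_Dr r.+1 V.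
have -> : tree_mass mu r V =
    k ^+ r.+1 * gc ^+ nedges V * (K%:R * (1 - Y)^-1 ^+ (K - 1) * (1 - Y)^-2).
  rewrite tree_massE// -/K; case: (posnP K) => [->|K0]; first by rewrite !(mul0r, mulr0).
  have gcE : gc = Y * (1 - Y) by rewrite /gc /Y; field; have := k0; lra.
  have YE : 1 - Y = k * Y by rewrite /Y; field; have := k0; lra.
  have -> : nedges V = (nedges V - K + K)%N by rewrite subnK// card_Dr_le_nedges.
  rewrite addnK exprD; case: (K) K0 => // K' _; rewrite subn1 /=.
  have -> : gc ^+ K'.+1 = Y ^+ K'.+1 * (1 - Y) ^+ K'.+1 by rewrite gcE exprMn.
  rewrite [in RHS]YE !exprS exprVn; field.
  by rewrite expf_neq0 ?mulf_neq0 ?gt_eqF.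
under eq_fun do rewrite mass_sumE//.
apply: cvgM; first exact: cvg_cst.
apply: cvgM; last exact: s1_cvg.
apply: cvgM; first exact: cvg_cst.
apply: (@cvg_comp _ _ _ s0 (fun x : R => x ^+ (K - 1)) _ _ _ s0_cvg); exact: exprn_continuous.
Qed.

Lemma mass_sum_nd r V : hle r.+1 V -> nondecreasing_seq (mass_sum r V).
Proof.
move=> hV M M' MM'; apply: ler_sum_subseq; [exact: fset_uniq|exact: fset_uniq| |].
  move=> T; rewrite !in_fset_set; [|exact: finite_trees_over|exact: finite_trees_over].
  move=> /set_mem [TV TA]; apply/mem_set; split=> // w /TA /in_stars [j jM E].
  by apply/in_stars; exists j => //; exact: leq_trans MM'.
by move=> T; exact: tree_mass_ge0.
Qed.

Lemma mass_sum_le r V M : tfin V -> hle r.+1 V -> mass_sum r V M <= tree_mass mu r V.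
Proof.
move=> Vf hV; rewrite -(cvg_lim (@Rhausdorff R) (mass_sum_cvg Vf hV)).
apply: nondecreasing_cvgn_le; first exact: mass_sum_nd.
by apply/cvg_ex; exists (tree_mass mu r V); exact: mass_sum_cvg.
Qed.

(** Numbering the finite trees lets their masses be summed as ordinary series and laid out as
    successive intervals. *)
Definition tcode T : nat := choice.pickle (enum_fset (vs T) : seq (seq nat)).

Lemma tcode_inj T T' : tfin T -> tfin T' -> tcode T = tcode T' -> T = T'.
Proof.
move=> Tf Tf' /(pcan_inj (@choice.pickleK _)) E; apply: vs_inj => //.
by apply/fsetP => v; rewrite -[LHS]/(v \in enum_fset (vs T)) E.
Qed.

Definition tdecode n : tree := xget tree1 [set T | tfin T /\ tcode T = n].

Lemma tcodeK T : tfin T -> tdecode (tcode T) = T.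
Proof.
move=> Tf; rewrite /tdecode; case: xgetP => [T' _ [Tf' E]|/(_ T)]; last first.
  by case; split.
exact: tcode_inj.
Qed.

(** Integers that are not codes receive mass 0, which neutralizes the default value of [tdecode]. *)
Definition code_mass r n : R :=
  if `[< tfin (tdecode n) /\ tcode (tdecode n) = n >] then tree_mass mu r (tdecode n) else 0.
Definition code_par r n := tcode (truncT r (tdecode n)).

Lemma code_mass_ge0 r n : 0 <= code_mass r n.
Proof. by rewrite /code_mass; case: ifP => // _; exact: tree_mass_ge0. Qed.

Lemma code_mass_tcode r T : tfin T -> code_mass r (tcode T) = tree_mass mu r T.
Proof.
move=> Tf; rewrite /code_mass tcodeK//; case: asboolP => // -[].
by split.
Qed.

Lemma code_mass_neq0 r n : code_mass r n != 0 ->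
  [/\ tfin (tdecode n), tcode (tdecode n) = n & height (tdecode n) = r.+1].
Proof.
rewrite /code_mass; case: asboolP => [[Tf Tn]|_]; last by rewrite eqxx.
by rewrite /tree_mass; case: (eqVneq (height _)) => [hT _|_]; [split|rewrite eqxx].
Qed.

Lemma height_truncT r T : tfin T -> height T = r.+2 -> height (truncT r T) = r.+1.
Proof.
move=> Tf hT; have tf := @tfin_truncT r T.
apply/eqP; rewrite eqn_leq; apply/andP; split; first by apply/heightP => // v [].
have [w [Tw sw]] := height_witness Tf hT.
have H : tverts (truncT r T) (take r.+1 w).
  by split; [exact: tree_take|rewrite size_takel// sw].
by have := hle_height tf H; rewrite size_takel ?sw.
Qed.

Let child r c j : R := if code_par r j == c then code_mass r.+1 j else 0.

Let child_ge0 r c j : 0 <= child r c j.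
Proof. by rewrite /child; case: ifP => // _; exact: code_mass_ge0. Qed.

Let child_neq0 r c j : child r c j != 0 -> exists T,
  [/\ tfin T, j = tcode T, height T = r.+2 & tcode (truncT r T) = c].
Proof.
rewrite /child; case: (eqVneq (code_par r j) c) => [jc|_]; last by rewrite eqxx.
by move=> /code_mass_neq0 [Tf E hT]; exists (tdecode j); split.
Qed.

Let over_children r V T : tfin T -> height T = r.+2 -> truncT r T = V ->
  forall M, (nedges T < M)%N -> trees_over r V (stars M) T.
Proof.
move=> Tf hT TV M MT; split=> // w; rewrite -TV Dr_truncT => Tw.
have hS : hle 2 (sub T w).
  by move: w Tw; apply/hle_sub; rewrite addn2 -hT; exact: hle_height.
have [j jE] := hle2_star hS; apply/in_stars; exists j => //.
apply: leq_trans MT; rewrite ltnS (nedges_graft r Tf).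
rewrite (bigD1_seq w) ?fset_uniq//=; last by have := (in_DrF r.+1 T w).2 Tw.
by rewrite jE nedges_star; lia.
Qed.

(* Kolmogorov consistency, stated on codes of trees. *)
Lemma child_series r c :
  series (fun j => if code_par r j == c then code_mass r.+1 j else 0) @ \oo
  --> code_mass r c.
Proof.
rewrite -/(child r c).
(* A child of nonzero mass has height r + 2, so its truncation has height r + 1 and positive mass: a
   null code has only null children. *)
have [c0|c0] := eqVneq (code_mass r c) 0.
  have z j : child r c j = 0.
    apply/eqP; apply: contraT => /child_neq0 [T [Tf jE hT cE]].
    have := tree_mass_gt0 (@tfin_truncT r T) (height_truncT Tf hT).
    by rewrite -code_mass_tcode ?cE ?c0 ?ltxx//; exact: tfin_truncT.
  rewrite c0.
  have -> : series (child r c) = fun=> 0.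
    by apply: funext => n; rewrite /series/= big1.
  exact: cvg_cst.
have [Vf cV hV] := code_mass_neq0 c0; set V := tdecode c in Vf cV hV.
have hleV : hle r.+1 V by rewrite -hV; exact: hle_height.
have cE : code_mass r c = tree_mass mu r V by rewrite -cV code_mass_tcode.
have enc M : \sum_(j <- [seq tcode T | T <- fset_set (trees_over r V (stars M))]) child r c j
    = mass_sum r V M.
  rewrite big_map; apply: eq_big_seq => T.
  rewrite in_fset_set; last exact: finite_trees_over.
  move=> /set_mem oT; have [Tf hT Te] := trees_over_stars hleV oT.
  rewrite /child /code_par tcodeK// (proj1 oT) cV eqxx code_mass_tcode//.
have enc_uniq M : uniq [seq tcode T | T <- fset_set (trees_over r V (stars M))].
  rewrite map_inj_in_uniq ?fset_uniq// => T T'; rewrite !in_fset_set; try exact: finite_trees_over.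
  move=> /set_mem oT /set_mem oT'.
  by apply: tcode_inj; [have [] := trees_over_stars hleV oT|have [] := trees_over_stars hleV oT'].
have upper n : series (child r c) n <= tree_mass mu r V.
  (* This exceeds the number of edges of every tree coded below n, hence all numbers of children
     that occur. *)
  pose M := (\sum_(j < n) nedges (tdecode j)).+1.
  apply: le_trans (mass_sum_le M Vf hleV); rewrite -enc /series/=.
  rewrite (bigID (fun j => child r c j != 0)) /= [X in _ + X]big1 ?addr0; last first.
    by move=> j /negPn/eqP.
  rewrite -big_filter; apply: ler_sum_subseq => //; first exact/filter_uniq/iota_uniq.
  move=> j; rewrite mem_filter mem_index_iota => /andP[/child_neq0 [T [Tf jE hT trE]] j_n].
  rewrite jE; apply/mapP; exists T => //; rewrite in_fset_set; last exact: finite_trees_over.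
  apply/mem_set; apply: over_children => //.
    by rewrite /V -trE tcodeK//; exact: tfin_truncT.
  have -> : nedges T = nedges (tdecode (Ordinal j_n : 'I_n)) by rewrite /= jE tcodeK.
  by rewrite ltnS (bigD1 (Ordinal j_n : 'I_n)) //= leq_addr.
have lower M : exists n, mass_sum r V M <= series (child r c) n.
  (* This bound exceeds every code in the list. *)
  exists (\sum_(j <- [seq tcode T | T <- fset_set (trees_over r V (stars M))]) j).+1.
  rewrite -enc /series/=; apply: ler_sum_subseq => //; first exact: iota_uniq.
  move=> j jin; rewrite mem_index_iota /= ltnS (bigD1_seq j) //= leq_addr//.
rewrite cE.
have nd : nondecreasing_seq (series (child r c)).
  by apply: nondecreasing_series => i _ _; exact: child_ge0.
have cs : cvgn (series (child r c)).
  by apply: nondecreasing_is_cvgn => //; exists (tree_mass mu r V) => _ [n _ <-].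
suff -> : tree_mass mu r V = limn (series (child r c)) by [].
apply/eqP; rewrite eq_le; apply/andP; split; last first.
  by apply: limr_le => //; exact: nearW.
apply: ler_cvgn (mass_sum_cvg Vf hleV) (@cvg_cst _ _ _ _ _) _ => M.
have [n Mn] := lower M; apply: le_trans Mn _.
exact: nondecreasing_cvgn_le.
Qed.

End Mass.

(** * Nested intervals *)

Section NestedIntervals.
Variables (R : realType) (q : nat -> nat -> R) (par : nat -> nat -> nat) (c0 : nat).
Hypothesis q_ge0 : forall r c, 0 <= q r c.
Hypothesis q_root : forall c, q 0 c = (c == c0)%:R.
Hypothesis q_par : forall r c,
  series (fun j => if par r j == c then q r.+1 j else 0) @ \oo --> q r c.

Let child r c j := if par r j == c then q r.+1 j else 0.
Let child_ge0 r c j : 0 <= child r c j.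
Proof. by rewrite /child; case: ifP. Qed.

Let child_nd r c : nondecreasing_seq (series (child r c)).
Proof. by apply: nondecreasing_series => i _ _. Qed.

Let child_le r c n : series (child r c) n <= q r c.
Proof.
rewrite -(cvg_lim (@Rhausdorff R) (@q_par r c)).
apply: (nondecreasing_cvgn_le (@child_nd r c)).
by apply/cvg_ex; exists (q r c); exact: q_par.
Qed.

(* The intervals of the children of a code are laid out from left to right in
   its own interval, so that the code at stage [r] of a uniform point of [0, 1[
   has law [q r]. *)
Fixpoint left_end r c : R :=
  if r is r'.+1 then left_end r' (par r' c) + series (child r' (par r' c)) c else 0.

Definition code_itv r c (x : R) := left_end r c <= x < left_end r c + q r c.

Lemma code_itv_par r c x : code_itv r.+1 c x -> code_itv r (par r c) x.
Proof.
move=> /= /andP[lx xr]; apply/andP; split.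
  apply: le_trans lx; rewrite lerDl /series/=; apply: sumr_ge0 => i _; exact: child_ge0.
apply: lt_le_trans xr _; rewrite -addrA lerD2l.
apply: le_trans (child_le r (par r c) c.+1); rewrite seriesSr lerD2l.
by rewrite /child eqxx.
Qed.

Lemma code_itv_root c x : code_itv 0 c x -> c = c0 /\ 0 <= x < 1.
Proof.
rewrite /code_itv /= q_root add0r; case: eqP => [-> //|_] /andP[x0 x1].
by have := le_lt_trans x0 x1; rewrite ltxx.
Qed.

Lemma code_itv_sub01 r c x : code_itv r c x -> 0 <= x < 1.
Proof.
elim: r c => [c /code_itv_root[]//|r IH c /code_itv_par]; exact: IH.
Qed.

Lemma code_itv_inj r c c' x : code_itv r c x -> code_itv r c' x -> c = c'.
Proof.
elim: r c c' => [c c' /code_itv_root[-> _] /code_itv_root[-> _]//|r IH c c' cx c'x].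
have E := IH _ _ (code_itv_par cx) (code_itv_par c'x).
wlog cc' : c c' cx c'x E / (c < c')%N.
  by move=> H; case: (ltngtP c c') => // h; [exact: H|symmetry; apply: H].
move: cx c'x; rewrite /code_itv /= -E => /andP[_ xr] /andP[xl _].
have H := @child_nd r (par r c) c.+1 c' cc'.
rewrite seriesSr {2}/child eqxx in H.
suff : x < x by rewrite ltxx.
by apply: lt_le_trans xr (le_trans _ xl); rewrite -addrA lerD2l.
Qed.

(** The child sought is the first index at which the partial sums pass x. The last increment is not
    zero there, so the parent of this index is [c]. *)
Lemma code_itv_ex r x : 0 <= x < 1 -> exists c, code_itv r c x.
Proof.
move=> x01; elim: r => [|r [c /andP[lx xr]]].
  by exists c0; rewrite /code_itv /= q_root eqxx add0r.
have ex : exists n, x < left_end r c + series (child r c) n.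
  have : \forall n \near \oo, x - left_end r c < series (child r c) n.
    have := @q_par r c; move/cvgr_gt; apply.
    by rewrite ltrBlDl.
  by move=> [N _ /(_ N (leqnn N))] /= H; exists N; rewrite -ltrBlDl.
case: (ex_minnP ex) => -[|n] xn minn.
  move: xn; rewrite /series/= big_geq// addr0 => /(le_lt_trans lx).
  by rewrite ltxx.
have lxn : left_end r c + series (child r c) n <= x.
  by rewrite leNgt; apply/negP => /minn; rewrite ltnn.
have pn : par r n = c.
  apply: contraTeq xn => pn; rewrite -leNgt seriesSr.
  by rewrite {2}/child (negbTE pn) addr0.
exists n; rewrite /code_itv /= pn lxn /=; apply: lt_le_trans xn _.
by rewrite seriesSr addrA /child pn eqxx.
Qed.

Lemma code_itvE r c : [set x | code_itv r c x] = `[left_end r c, left_end r c + q r c[%classic.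
Proof. by apply/seteqP; split=> x /=; rewrite in_itv. Qed.

Lemma lebesgue_code_itv r c : lebesgue_measure [set x | code_itv r c x] = (q r c)%:E.
Proof.
rewrite code_itvE lebesgue_measure_itv /= lte_fin ltrDl.
case: ltP => [_|q0]; first by rewrite -EFinD addrC addKr.
by congr EFin; apply/eqP; rewrite eq_le q_ge0 q0.
Qed.

Definition point_code r x : nat := xget 0%N [set c | code_itv r c x].

Lemma point_codeP r x : 0 <= x < 1 -> code_itv r (point_code r x) x.
Proof.
move=> /(code_itv_ex r)[c cx]; rewrite /point_code; case: xgetP => [y _ //|/(_ c)].
by move/(_ cx).
Qed.

Lemma point_codeE r c x : 0 <= x < 1 -> point_code r x = c <-> code_itv r c x.
Proof.
move=> x01; split=> [<-|]; first exact: point_codeP.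
exact/code_itv_inj/point_codeP.
Qed.

Lemma point_code_par r x : 0 <= x < 1 -> par r (point_code r.+1 x) = point_code r x.
Proof.
by move=> x01; symmetry; apply/point_codeE => //; apply/code_itv_par/point_codeP.
Qed.

(** A half-open interval containing a point has positive length: no point ever meets a null code,
    and every tree read off a point has full height. *)
Lemma point_code_mass r x : 0 <= x < 1 -> 0 < q r (point_code r x).
Proof.
move=> /(point_codeP r) /andP[xl xr]; have := le_lt_trans xl xr.
by rewrite ltrDl.
Qed.

End NestedIntervals.

(** * The space of trees *)

Section TreeTopology.
Variable R : realType.
Implicit Types (T V : tree) (r n : nat).

Definition cell r V : set tree := [set T | truncT r T = V].

Let dist_set T T' : set R :=
  [set (r%:R)^-1 | r in [set r : nat | (0 < r)%N /\ trunc r T = trunc r T']].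

Let dist_lb T T' : has_lbound (dist_set T T').
Proof. by exists 0 => _ [r _ <-]; rewrite invr_ge0. Qed.

Let dist_ne T T' : dist_set T T' !=set0.
Proof.
exists 1, 1%N; rewrite ?invr1//; split=> //.
by apply/truncT_eq; rewrite !truncT_tree1.
Qed.

Lemma tdist_le r T T' : truncT r T = truncT r T' -> tdist R T T' <= (r.+1%:R)^-1.
Proof. by move=> /truncT_eq E; apply: (ge_inf (dist_lb T T')); exists r.+1. Qed.

Lemma tdist_lt r T T' : tdist R T T' < (r.+1%:R)^-1 -> truncT r T = truncT r T'.
Proof.
move=> /(inf_lt (dist_ne T T'))[_ [[|r'] [// _ E] <-]] h.
have rr' : (r < r')%N by move: h; rewrite ltf_pV2 ?posrE ?ltr0n// ltr_nat ltnS.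
rewrite -(truncT_truncT T (ltnW rr')) -(truncT_truncT T' (ltnW rr')).
by congr truncT; apply/truncT_eq.
Qed.

Lemma inv_small (e : R) : 0 < e -> exists r, (r.+1%:R)^-1 < e.
Proof.
move=> e0; have := @near_infty_natSinv_lt R (PosNum e0).
by move=> [N _ /(_ N (leqnn N))] /=; exists N.
Qed.

Lemma topenP (A : set tree) : topen R A <->
  forall T, A T -> exists r, forall T', truncT r T' = truncT r T -> A T'.
Proof.
split=> H T /H.
  move=> [e e0 HA]; have [r re] := inv_small e0; exists r => T' E.
  by apply: HA; apply: le_lt_trans re; apply: tdist_le.
move=> [r HA]; exists (r.+1%:R)^-1; first by rewrite invr_gt0.
by move=> T' /tdist_lt E; apply: HA.
Qed.

Lemma tcontinuousP (f : tree -> R) : tcontinuous f -> forall T (e : R), 0 < e ->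
  exists r, forall T', truncT r T' = truncT r T -> `|f T - f T'| < e.
Proof.
move=> fc T e e0; have [d d0 Hd] := fc T e e0; have [r re] := inv_small d0.
by exists r => T' E; apply: Hd; apply: le_lt_trans re; apply: tdist_le.
Qed.

Lemma topen_level r (P : set tree) : topen R [set T | P (truncT r T)].
Proof. by apply/topenP => T /= PT; exists r => T' /= ->. Qed.

Lemma tdecode_fin n : tfin (tdecode n).
Proof.
rewrite /tdecode; case: xgetP => [T _ []//|_].
by rewrite tree1_star; exact: tfin_star.
Qed.

(** Truncations are finite trees and therefore have codes. Open sets are thus countable unions of
    cells, and the cells, stable under intersection, generate the Borel sets. *)
Lemma topen_cover (A : set tree) : topen R A ->
  A = \bigcup_r \bigcup_n
    (if `[< cell r (tdecode n) `<=` A >] then cell r (tdecode n) else set0).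
Proof.
move=> /topenP oA; apply/seteqP; split=> [T /[dup] AT /oA [r HT]|T [r _ [n _]]].
  exists r => //; exists (tcode (truncT r T)) => //.
  rewrite tcodeK; last exact: tfin_truncT.
  by case: asboolP => // -[] T' E; apply: HT.
by case: asboolP => // /[apply].
Qed.

Definition cells : set (set tree) := [set A | A = set0 \/ exists r V, A = cell r V].

Lemma cells_setI : setI_closed cells.
Proof.
move=> A B [->|[r [V ->]]]; first by rewrite set0I; left.
move=> [->|[r' [V' ->]]]; first by rewrite setI0; left.
wlog rr' : r r' V V' / (r <= r')%N.
  move=> H; case: (leqP r r') => [|/ltnW]; first exact: H.
  by rewrite setIC; exact: H.
case: (pselect (truncT r V' = V)) => [E|nE].
  right; exists r', V'; apply/seteqP; split=> [T []//|T TV'].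
  by split=> //; rewrite /cell /= -E -TV' truncT_truncT.
left; apply/seteqP; split=> // T [TV TV']; apply: nE.
by rewrite -TV' truncT_truncT.
Qed.

Lemma sigma_cells : <<s @topen R >> = <<s cells >>.
Proof.
apply/seteqP; split.
  apply: smallest_sub; first exact: smallest_sigma_algebra.
  move=> A /topen_cover ->.
  have [h0 hC hU] := @smallest_sigma_algebra _ setT cells.
  apply: (hU) => r; apply: (hU) => n; case: ifP => _; last exact: h0.
  by apply: sub_sigma_algebra; right; exists r, (tdecode n).
apply: smallest_sub; first exact: smallest_sigma_algebra.
move=> A [->|[r [V ->]]].
  by have [] := @smallest_sigma_algebra _ setT (@topen R).
by apply: sub_sigma_algebra; apply: (@topen_level r [set V]).
Qed.

Lemma measurable_cells : @measurable _ (treeB R) = <<s cells >>.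
Proof. by rewrite -sigma_cells. Qed.

Lemma measurable_level r (P : set tree) :
  measurable ([set T | P (truncT r T)] : set (treeB R)).
Proof. by apply: sub_sigma_algebra; exact: topen_level. Qed.

Lemma measurable_cell r V : measurable (cell r V : set (treeB R)).
Proof. exact: (@measurable_level r [set V]). Qed.

Lemma tcontinuous_measurable (f : treeB R -> R) : tcontinuous f ->
  measurable_fun [set: treeB R] f.
Proof.
move=> fc; apply: (measurability _ (measurable_realfun.RGenOInfty.measurableE R)).
move=> _ [_ [x ->] <-]; rewrite setTI; apply: sub_sigma_algebra.
apply/topenP => T /=; rewrite in_itv /= andbT -subr_gt0 => fx.
have [r Hr] := tcontinuousP fc T fx; exists r => T' /Hr.
rewrite /= in_itv /= andbT ltr_norml => /andP[_].
by rewrite ltrD2l ltrN2.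
Qed.

Lemma tree_measure_unique (m1 m2 : probability (treeB R) R) :
  (forall r V, m1 (cell r V) = m2 (cell r V)) ->
  forall A, measurable A -> m1 A = m2 A.
Proof.
move=> m12 A mA.
apply: (@measure_unique _ R (treeB R) cells (fun=> setT) measurable_cells
  cells_setI _ _ m1 m2 _ _ A mA).
- move=> _; right; exists 0%N, tree1; apply/seteqP; split=> // T _.
  exact: truncT_tree1.
- by apply/seteqP; split=> // T _; exists 0%N.
- by move=> B [->|[r [V ->]]]; [rewrite !measure0|exact: m12].
- move=> i; apply: (@le_lt_trans _ _ 1%E); last exact: ltry.
  exact: (probability_le1 m1 measurableT).
Qed.

End TreeTopology.

(** * Projective limits of trees *)

Section TreeLimit.
Variables (t : nat -> tree).
Hypothesis t_proj : forall r, truncT r (t r.+1) = t r.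

Let t_proj2 r r' : (r <= r')%N -> truncT r (t r') = truncT r (t r).
Proof.
move=> rr'; rewrite -(subnK rr'); elim: (r' - r)%N => [//|n IH].
by rewrite addSn -(truncT_truncT _ (leq_addl n r)) t_proj IH.
Qed.

(** By compatibility, a vertex v gets the same answer at every level r with size v <= r + 1; the
    level [size v] is one such choice. *)
Definition tlim_verts : set (seq nat) := [set v | tverts (t (size v)) v].

Let tE r r' v : (r <= r')%N -> (size v <= r.+1)%N -> tverts (t r) v <-> tverts (t r') v.
Proof.
move=> /t_proj2 /truncT_eq /= E vr; split=> H.
  by have : trunc r.+1 (t r) v by []; rewrite -E => -[].
by have : trunc r.+1 (t r') v by []; rewrite E => -[].
Qed.

Let tlimE r v : (size v <= r.+1)%N -> tlim_verts v <-> tverts (t r) v.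
Proof.
move=> vr; rewrite /tlim_verts /=; case: (leqP (size v) r) => [h|/ltnW h].
  exact: tE.
by symmetry; apply: tE.
Qed.

Lemma tlim_ax : is_tree tlim_verts.
Proof.
split.
- exact: tree_nil.
- split; first exact: tree_0.
  by move/tree_head.
- move=> v i; rewrite /tlim_verts /= size_rcons => /tree_rcons H.
  by apply/(tlimE (r := (size v).+1)) => //; rewrite ltnW.
- move=> v i; rewrite /tlim_verts /= !size_rcons; exact: tree_sib.
- move=> v; have [n Hn] := tree_locfin (t (size v).+1) v; exists n.
  by rewrite /tlim_verts /= size_rcons.
Qed.

Lemma tlim_ex : exists T, forall r, truncT r T = truncT r (t r).
Proof.
exists (Tree tlim_ax) => r; apply: treeP => v /=.
by split=> -[H vr]; split=> //; apply/(tlimE vr).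
Qed.

End TreeLimit.

(** * Construction of the limit measure *)

Section TreeMeasure.
Variables (R : realType) (mu : R).
Hypothesis hmu : mu < 0.
Implicit Types (T V : tree) (r n : nat).

Let q := code_mass mu.
Let c0 := tcode tree1.

Let tree1_fin : tfin tree1.
Proof. by rewrite tree1_star; exact: tfin_star. Qed.

Lemma code_mass_root c : q 0 c = (c == c0)%:R.
Proof.
case: eqP => [->|nc]; first by rewrite /q code_mass_tcode// tree_mass1.
apply/eqP; apply: contra_notT nc => /code_mass_neq0 [Tf E hT]; rewrite -E; congr tcode.
apply: hle1_tree1; have := hle_height Tf; rewrite hT; exact.
Qed.

Let q_ge0 r c : 0 <= q r c. Proof. exact: code_mass_ge0. Qed.
Let q_par r c : series (fun j => if code_par r j == c then q r.+1 j else 0) @ \oo --> q r c.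
Proof. exact: child_series. Qed.

Let point_tree r x := tdecode (point_code q code_par r x).

(** On [0, 1[ the prescribed truncations are compatible and determine the tree; the values elsewhere
    are discarded by [treenu]. *)
Definition random_tree (x : R) : tree :=
  xget tree1 [set T | forall r, truncT r T = point_tree r x].

Let D : set (measurableTypeR R) := `[0, 1[%classic.

Let point_treeP x r : D x -> tcode (point_tree r x) = point_code q code_par r x /\
  height (point_tree r x) = r.+1.
Proof.
rewrite /D /= in_itv /= => x01.
have := point_code_mass code_mass_root q_par r x01.
by rewrite lt_neqAle eq_sym => /andP[/code_mass_neq0[_ ? ?] _].
Qed.

Lemma truncT_random_tree x r : D x -> truncT r (random_tree x) = point_tree r x.
Proof.
move=> Dx; have x01 : 0 <= x < 1 by move: Dx; rewrite /D /= in_itv.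
have proj i : truncT i (point_tree i.+1 x) = point_tree i x.
  have := point_code_par q_ge0 code_mass_root q_par i x01.
  rewrite /code_par -/(point_tree i.+1 x) => /(congr1 tdecode).
  by rewrite tcodeK//; exact: tfin_truncT.
have [T HT] := tlim_ex proj.
rewrite /random_tree; case: xgetP => [T' _ //|/(_ T)[]] i.
rewrite HT truncT_id//; have [_ <-] := point_treeP i Dx.
exact/hle_height/tdecode_fin.
Qed.

Lemma random_tree_cell x r V : D x -> tfin V ->
  cell r V (random_tree x) <-> code_itv q code_par r (tcode V) x.
Proof.
move=> Dx Vf; rewrite /cell /= truncT_random_tree//.
have x01 : 0 <= x < 1 by move: Dx; rewrite /D /= in_itv.
rewrite -(point_codeE q_ge0 code_mass_root q_par)//.
have [E _] := point_treeP r Dx.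
by split=> [<-//|E']; rewrite /point_tree E' tcodeK.
Qed.

Let preimage_cell r V : tfin V ->
  D `&` random_tree @^-1` (cell r V) = [set x | code_itv q code_par r (tcode V) x].
Proof.
move=> Vf; apply/seteqP; split=> [x [Dx /(random_tree_cell _ Dx Vf)//]|x cx].
have Dx : D x.
  rewrite /D /= in_itv /=.
  exact: (code_itv_sub01 q_ge0 code_mass_root q_par cx).
by split=> //; apply/random_tree_cell.
Qed.

Let preimage_cell0 r V : ~ tfin V -> D `&` random_tree @^-1` (cell r V) = set0.
Proof.
move=> nV; apply/seteqP; split=> // x [_]; rewrite /cell /= => E; apply: nV.
by rewrite -E; exact: tfin_truncT.
Qed.

Lemma measurable_random_tree :
  measurable_fun D (random_tree : measurableTypeR R -> treeB R).
Proof.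
apply: (measurability _ (@measurable_cells R)) => _ [_ [->|[r [V ->]]] <-].
  by rewrite preimage_set0 setI0.
have [Vf|nV] := pselect (tfin V); last by rewrite preimage_cell0.
by rewrite preimage_cell// code_itvE; exact: measurable_itv.
Qed.

Let mD : measurable D. Proof. exact: measurable_itv. Qed.

Definition treenu (A : set (treeB R)) : \bar R :=
  lebesgue_measure (D `&` random_tree @^-1` A).

Let treenu0 : treenu set0 = 0%E.
Proof. by rewrite /treenu preimage_set0 setI0 measure0. Qed.
Let treenu_ge0 A : (0 <= treenu A)%E.
Proof. exact: measure_ge0. Qed.
Let treenu_sigma_additive : semi_sigma_additive treenu.
Proof.
move=> F mF tF mUF; rewrite /treenu preimage_bigcup setI_bigcupr.
apply: measure_semi_sigma_additive.
- by move=> n; exact: measurable_random_tree.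
- apply/trivIsetP => /= i j _ _ ij; rewrite setIACA setIid -preimage_setI.
  by move/trivIsetP : tF => /(_ _ _ _ _ ij) ->//; rewrite preimage_set0 setI0.
- by rewrite -setI_bigcupr -preimage_bigcup; exact: measurable_random_tree.
Qed.

HB.instance Definition _ := isMeasure.Build _ _ _ treenu
  treenu0 treenu_ge0 treenu_sigma_additive.

Let treenu_setT : treenu setT = 1%E.
Proof.
rewrite /treenu preimage_setT setIT lebesgue_measure_itv /= lte_fin ltr01.
by rewrite oppr0 adde0.
Qed.

HB.instance Definition _ := Measure_isProbability.Build _ _ _ treenu treenu_setT.

Lemma tree_measure_ex : exists nu : probability (treeB R) R,
  forall r V, tfin V -> nu (cell r V) = (tree_mass mu r V)%:E.
Proof.
exists treenu => r V Vf; rewrite /= /treenu preimage_cell//.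
by rewrite lebesgue_code_itv; [rewrite /q code_mass_tcode|exact: q_ge0].
Qed.

End TreeMeasure.

(** * Weak convergence *)

Lemma cvg_sum_ord (R : realType) n (F : nat -> nat -> R) (l : nat -> R) :
  (forall j, F j N @[N --> \oo] --> l j) ->
  (\sum_(j < n) F j N) @[N --> \oo] --> \sum_(j < n) l j.
Proof.
move=> Fl; elim: n => [|n IH].
  by under eq_fun do rewrite big_ord0; rewrite big_ord0; exact: cvg_cst.
under eq_fun do rewrite big_ord_recr; rewrite big_ord_recr.
by apply: cvgD; [exact: IH|exact: Fl].
Qed.

Section Convergence.
Variables (R : realType) (mu : R).
Hypothesis hmu : mu < 0.
Implicit Types (T V : tree) (r n : nat).
Variable nu : probability (treeB R) R.
Hypothesis nu_cell : forall r V, tfin V -> nu (cell r V) = (tree_mass mu r V)%:E.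

(** For fixed r these sets partition the space into countably many pieces, each of them a cell or
    empty. *)
Definition codecell r n : set (treeB R) := [set T | tcode (truncT r T) = n].

Lemma measurable_codecell r n : measurable (codecell r n).
Proof. exact: (@measurable_level R r [set V | tcode V = n]). Qed.

Lemma codecellE r n : codecell r n = cell r (tdecode n) \/ codecell r n = set0.
Proof.
have [[T HT]|H] := pselect (exists T, tcode (truncT r T) = n).
  left; apply/seteqP; split=> T' /=; rewrite /codecell /cell /=.
    by move=> <-; rewrite tcodeK//; exact: tfin_truncT.
  by move=> ->; rewrite -HT tcodeK//; exact: tfin_truncT.
by right; apply/seteqP; split=> // T HT; apply: H; exists T.
Qed.

Lemma probN_codecell r n :
  probN mu N (fun T => tcode (truncT r T) == n) @[N --> \oo] --> fine (nu (codecell r n)).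
Proof.
have [[T HT]|H] := pselect (exists T, tcode (truncT r T) = n).
  have dE : tdecode n = truncT r T by rewrite -HT tcodeK//; exact: tfin_truncT.
  have -> : codecell r n = cell r (tdecode n).
    have [//|E0] := codecellE r n.
    by have : codecell r n T by []; rewrite E0.
  rewrite nu_cell; last exact: tdecode_fin.
  have -> : (fun N => probN mu N (fun T => tcode (truncT r T) == n)) =
      (fun N => probN mu N (fun T => truncT r T == tdecode n)).
    apply: funext => N; apply: eq_bigl => T'; apply/eqP/eqP => [<-|->].
      by rewrite tcodeK//; exact: tfin_truncT.
    by rewrite dE HT.
  apply: ball_limit => //; first exact: tdecode_fin.
  by rewrite dE; exact: hle_truncT.
have -> : codecell r n = set0 by apply/seteqP; split=> // T HT; apply: H; exists T.
rewrite measure0.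
have -> : (fun N => probN mu N (fun T => tcode (truncT r T) == n)) = fun=> 0.
  apply: funext => N; rewrite /probN big1// => T /eqP HT.
  by exfalso; apply: H; exists T.
exact: cvg_cst.
Qed.

Lemma tbounded_integrable (f : treeB R -> R) : tbounded f ->
  measurable_fun setT f -> nu.-integrable setT (EFin \o f).
Proof.
move=> [M fM] mf; apply: measurable_bounded_integrable => //.
- by rewrite (le_lt_trans (probability_le1 nu measurableT))// ltry.
- by exists M; split; [exact: num_real|move=> x Mx T _; exact: le_trans (fM T) (ltW Mx)].
Qed.

Section LevelFunction.
Variables (r n : nat) (h : treeB R -> R).
Hypothesis h_level : forall T, h T = h (truncT r T).
Hypothesis h_supp : forall T, (n <= tcode (truncT r T))%N -> h T = 0.

Lemma level_tcontinuous : tcontinuous h.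
Proof.
move=> T e e0; exists (r.+1%:R)^-1; first by rewrite invr_gt0.
move=> T' /tdist_lt E; rewrite h_level [h T']h_level E subrr normr0//.
Qed.

Let h_sum T : h T = \sum_(j < n) h (tdecode j) * (tcode (truncT r T) == j)%:R.
Proof.
have [nT|Tn] := leqP n (tcode (truncT r T)).
  rewrite h_supp// big1// => j _; case: eqP => [E|]; rewrite ?mulr0//.
  by have := ltn_ord j; rewrite -E ltnNge nT.
rewrite (bigD1 (Ordinal Tn)) //= eqxx mulr1 big1 ?addr0.
  rewrite tcodeK -?h_level//; exact: tfin_truncT.
move=> j /eqP jT; case: eqP => [E|]; rewrite ?mulr0//.
by exfalso; apply: jT; apply: val_inj; rewrite /= E.
Qed.

Let indE j T : (tcode (truncT r T) == j)%:R = \1_(codecell r j) T :> R.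
Proof.
rewrite indicE; congr (nat_of_bool _)%:R; apply/idP/idP => [/eqP E|]; first exact/mem_set.
by move=> /set_mem ->.
Qed.

Let int_ind j : nu.-integrable setT (fun T => ((tcode (truncT r T) == j)%:R)%:E).
Proof.
under eq_fun => T do rewrite indE.
by apply: integrable_indic; exact: measurable_codecell.
Qed.

Let ind_int j : (\int[nu]_T ((tcode (truncT r T) == j)%:R)%:E)%E = nu (codecell r j).
Proof.
under eq_integral => T _ do rewrite indE.
by rewrite integral_indic ?setIT//; exact: measurable_codecell.
Qed.

(** Such a function is a finite combination of indicators of cells, whose probabilities converge by
    [ball_limit]. *)
Lemma level_EnuN_cvg : EnuN mu N h @[N --> \oo] --> \int[nu]_T h T.
Proof.
have -> : \int[nu]_T h T = \sum_(j < n) h (tdecode j) * fine (nu (codecell r j)).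
  have E : (\int[nu]_T (h T)%:E = (\sum_(j < n) h (tdecode j) * fine (nu (codecell r j)))%:E)%E.
    under eq_integral => T _ do rewrite h_sum -sumEFin.
    rewrite integral_sum//.
      rewrite -sumEFin; apply: eq_bigr => j _.
      under eq_integral => T _ do rewrite EFinM.
      rewrite integralZl//.
      by rewrite EFinM fineK ?fin_num_measure ?ind_int//; exact: measurable_codecell.
    move=> j; under eq_fun => T do rewrite EFinM.
    by apply: integrableZl => //; exact: int_ind.
  by rewrite /Rintegral E.
have -> : (fun N => EnuN mu N h) = (fun N => \sum_(j < n)
    h (tdecode j) * probN mu N (fun T => tcode (truncT r T) == j)).
  apply: funext => N; rewrite EnuNE.
  under eq_bigr do rewrite h_sum mulr_suml.
  rewrite exchange_big /=; apply: eq_bigr => j _.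
  rewrite /probN mulr_sumr [RHS]big_mkcond; apply: eq_bigr => T _.
  by case: eqP; rewrite ?mulr1 ?mulr0 ?mul0r.
have := @cvg_sum_ord R n (fun j N : nat => h (tdecode j) *
  probN mu N (fun T => tcode (truncT r T) == j))
  (fun j => h (tdecode j) * fine (nu (codecell r j))); apply=> j.
apply: cvgM; first exact: cvg_cst.
exact: probN_codecell.
Qed.

End LevelFunction.

Section WeakLimit.
Variables (f : treeB R -> R) (M : R).
Hypothesis f_le : forall T, `|f T| <= M.
Hypothesis f_cont : tcontinuous f.

Let M_ge0 : 0 <= M. Proof. exact: le_trans (normr_ge0 _) (f_le tree1). Qed.

(* The oscillation is taken over pairs of trees of the cell, and not with respect
   to a centre, so that having small oscillation is monotone in [r]. *)
Definition small_osc (e : R) r V := forall T T',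
  truncT r T = V -> truncT r T' = V -> `|f T - f T'| <= e.

Definition good_level e r n : set (treeB R) :=
  [set T | small_osc e r (truncT r T) /\ (tcode (truncT r T) < n)%N].

Let measurable_good e r n : measurable (good_level e r n).
Proof. exact: (@measurable_level R r [set V | small_osc e r V /\ (tcode V < n)%N]). Qed.

(** By continuity of f every tree has small oscillation from some level on. Continuity of the
    measure from below is applied twice, to the level and then to the bound on the codes. *)
Lemma good_level_ex e : 0 < e -> exists r n, 1 - e < fine (nu (good_level e r n)).
Proof.
move=> e0; pose G r : set (treeB R) := [set T | small_osc e r (truncT r T)].
have mG r : measurable (G r) by exact: (@measurable_level R r [set V | small_osc e r V]).
have GT : \bigcup_r G r = setT.
  apply/seteqP; split=> // T _; have e20 : 0 < e / 2 by rewrite divr_gt0.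
  have [r Hr] := tcontinuousP f_cont T e20; exists r => // T1 T2 /Hr h1 /Hr h2.
  have -> : f T1 - f T2 = (f T - f T2) - (f T - f T1) by ring.
  by apply: le_trans (ler_normB _ _) _; lra.
have ndG : nondecreasing_seq G.
  move=> r r' rr'; apply/subsetPset => T oT T1 T2 E1 E2; apply: oT.
    by rewrite -(truncT_truncT T1 rr') E1 truncT_truncT.
  by rewrite -(truncT_truncT T2 rr') E2 truncT_truncT.
have cG : fine (nu (G r)) @[r --> \oo] --> (1 : R).
  apply: fine_cvg; rewrite -(probability_setT nu) -GT.
  by apply: nondecreasing_cvg_mu => //; rewrite GT.
have [r Gr] : exists r, 1 - e / 2 < fine (nu (G r)).
  have h : 1 - e / 2 < 1 by rewrite ltrBlDr ltrDl divr_gt0.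
  by have /cvgr_gt/(_ _ h)[N _ /(_ N (leqnn N)) /= H] := cG; exists N.
have FG : \bigcup_n good_level e r n = G r.
  apply/seteqP; split=> [T [n _ []]//|T GT'].
  by exists (tcode (truncT r T)).+1.
have cF : fine (nu (good_level e r n)) @[n --> \oo] --> fine (nu (G r)).
  apply: fine_cvg; rewrite fineK ?fin_num_measure// -FG.
  apply: nondecreasing_cvg_mu => //; first by rewrite FG.
  move=> n n' nn'; apply/subsetPset => T [oT Tn]; split=> //.
  exact: leq_trans nn'.
have h : 1 - e < fine (nu (G r)) by apply: lt_trans Gr; rewrite ltrD2l ltrN2; lra.
have /cvgr_gt/(_ _ h)[n _ /(_ n (leqnn n)) /= Hn] := cF.
by exists r, n.
Qed.

Section Estimate.
Variables (e : R) (r n : nat).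
Hypothesis e_ge0 : 0 <= e.

Let good T := `[< good_level e r n T >].
Let ind T : R := if good T then 1 else 0.
(** The function f is frozen at the truncation on the good part and set to 0 elsewhere; being
    determined by finitely many cells, it has convergent expectations. *)
Let cut T : R := if good T then f (truncT r T) else 0.

Let good_trunc T : good (truncT r T) = good T.
Proof. by rewrite /good /good_level /= truncT_truncT. Qed.

Let good_supp T : (n <= tcode (truncT r T))%N -> good T = false.
Proof. by move=> nT; apply/asboolPn => -[_]; rewrite ltnNge nT. Qed.

Let ind_level T : ind T = ind (truncT r T).
Proof. by rewrite /ind good_trunc. Qed.
Let cut_level T : cut T = cut (truncT r T).
Proof. by rewrite /cut good_trunc truncT_truncT. Qed.
Let ind_supp T : (n <= tcode (truncT r T))%N -> ind T = 0.
Proof. by move=> /good_supp; rewrite /ind => ->. Qed.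
Let cut_supp T : (n <= tcode (truncT r T))%N -> cut T = 0.
Proof. by move=> /good_supp; rewrite /cut => ->. Qed.

Let cut_near T : `|f T - cut T| <= e + M * (1 - ind T).
Proof.
rewrite /cut /ind; case: ifP => [/asboolP[oT _]|_].
  by rewrite subrr mulr0 addr0; apply: oT => //; rewrite truncT_truncT.
by rewrite !subr0 mulr1; apply: le_trans (f_le T) _; rewrite lerDr.
Qed.

Let mind : measurable_fun setT (ind : treeB R -> R).
Proof.
apply: tcontinuous_measurable; apply: (@level_tcontinuous r) => T; exact: ind_level.
Qed.
Let mcut : measurable_fun setT (cut : treeB R -> R).
Proof.
apply: tcontinuous_measurable; apply: (@level_tcontinuous r) => T; exact: cut_level.
Qed.
Let mf : measurable_fun setT f.
Proof. exact: tcontinuous_measurable. Qed.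
Let int_f : nu.-integrable setT (EFin \o f).
Proof. by apply: tbounded_integrable => //; exists M. Qed.
Let int_cut : nu.-integrable setT (EFin \o cut).
Proof.
apply: tbounded_integrable => //; exists M => T; rewrite /cut.
by case: ifP => _; rewrite ?normr0.
Qed.
Let ind01 T : 0 <= ind T <= 1.
Proof. by rewrite /ind; case: ifP; rewrite ?lexx ?ler01. Qed.
Let int_ind' : nu.-integrable setT (EFin \o ind).
Proof.
apply: tbounded_integrable => //; exists 1 => T.
by have /andP[i0 i1] := ind01 T; rewrite ger0_norm.
Qed.

Lemma integral_ind : \int[nu]_T ind T = fine (nu (good_level e r n)).
Proof.
rewrite /Rintegral; congr fine.
under eq_integral => T _.
  have -> : ind T = \1_(good_level e r n) T.
    by rewrite indicE /ind /good; case: asboolP => h; [rewrite mem_set|rewrite memNset].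
  over.
by rewrite integral_indic ?setIT.
Qed.

Lemma integral_cut_near :
  `|\int[nu]_T f T - \int[nu]_T cut T| <= e + M * (1 - \int[nu]_T ind T).
Proof.
have int_sub : nu.-integrable setT (EFin \o (fun T => f T - cut T)).
  apply: tbounded_integrable; last exact: measurable_funB.
  exists (e + M) => T; apply: le_trans (cut_near T) _.
  rewrite lerD2l -[leRHS]mulr1 ler_wpM2l// lerBlDr lerDl.
  by have /andP[] := ind01 T.
rewrite -RintegralB//; apply: le_trans (le_normr_Rintegral _ int_sub) _ => //.
have intc : nu.-integrable setT (EFin \o (fun _ : treeB R => e + M)).
  exact: finite_measure_integrable_cst.
have intM : nu.-integrable setT (EFin \o (fun T => - M * ind T)).
  apply: tbounded_integrable; last by apply: measurable_funM => //; exact: measurable_cst.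
  exists M => T; rewrite normrM normrN (ger0_norm M_ge0) -[leRHS]mulr1 ler_wpM2l//.
  by have /andP[i0 i1] := ind01 T; rewrite ger0_norm.
have -> : e + M * (1 - \int[nu]_T ind T) = \int[nu]_T ((e + M) + (- M) * ind T).
  rewrite RintegralD// Rintegral_cst// RintegralZl//.
  by rewrite [fine _](_ : _ = 1); [ring|exact: (congr1 fine (probability_setT nu))].
apply: le_Rintegral => //.
- apply: tbounded_integrable; last first.
    by apply: (measurableT_comp (@normr_measurable R setT)); exact: measurable_funB.
  exists (e + M) => T; rewrite normr_id; apply: le_trans (cut_near T) _.
  rewrite lerD2l -[leRHS]mulr1 ler_wpM2l// lerBlDr lerDl.
  by have /andP[] := ind01 T.
- apply: tbounded_integrable; last first.
    by apply: measurable_funD; [exact: measurable_cst|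
       apply: measurable_funM => //; exact: measurable_cst].
  exists (e + M) => T.
  have -> : e + M + - M * ind T = e + M * (1 - ind T) by ring.
  have /andP[i0 i1] := ind01 T.
  rewrite ger0_norm; last by rewrite addr_ge0 ?mulr_ge0 ?subr_ge0.
  by rewrite lerD2l -[leRHS]mulr1 ler_wpM2l// lerBlDr lerDl.
- move=> T _; have -> : e + M + - M * ind T = e + M * (1 - ind T) by ring.
  exact: cut_near.
Qed.

(** The total mass is kept as [probN mu N predT]: it is 0 at N = 0, since no tree has 0 edges, and
    only its limit 1 enters. *)
Lemma EnuN_cut_near N : `|EnuN mu N f - EnuN mu N cut| <=
  e * probN mu N predT + M * (probN mu N predT - EnuN mu N ind).
Proof.
rewrite !EnuNE /probN -sumrB; apply: le_trans (ler_norm_sum _ _ _) _.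
rewrite -sumrB !mulr_sumr -big_split /=; apply: ler_sum => T _.
have nu0 := @nuN_ge0 R mu N T.
rewrite -mulrBl normrM (ger0_norm nu0).
have -> : e * nuN mu N T + M * (nuN mu N T - ind T * nuN mu N T) =
  (e + M * (1 - ind T)) * nuN mu N T by ring.
by rewrite ler_wpM2r// cut_near.
Qed.

Lemma EnuN_cut_cvg : EnuN mu N cut @[N --> \oo] --> \int[nu]_T cut T.
Proof. exact: (level_EnuN_cvg cut_level cut_supp). Qed.
Lemma EnuN_ind_cvg : EnuN mu N ind @[N --> \oo] --> \int[nu]_T ind T.
Proof. exact: (level_EnuN_cvg ind_level ind_supp). Qed.

Lemma EnuN_near : 0 < e -> 1 - e < fine (nu (good_level e r n)) -> e <= 1 ->
  \forall N \near \oo, `|\int[nu]_T f T - EnuN mu N f| <= (4 + 4 * M) * e.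
Proof.
move=> e0 Fe e1; near=> N.
have hc : `|\int[nu]_T cut T - EnuN mu N cut| <= e.
  by near: N; have /cvgrPdist_le/(_ e e0) := EnuN_cut_cvg.
have hi : `|\int[nu]_T ind T - EnuN mu N ind| <= e.
  by near: N; have /cvgrPdist_le/(_ e e0) := EnuN_ind_cvg.
have h1 : `|1 - probN mu N predT| <= e.
  by near: N; have /cvgrPdist_le/(_ e e0) := (probN_total hmu).
have hN := EnuN_cut_near N.
have hI := integral_cut_near.
rewrite -integral_ind in Fe.
set a := \int[nu]_T f T in hI *; set b := \int[nu]_T cut T in hI hc.
set i := \int[nu]_T ind T in hI hi Fe.
set x := EnuN mu N f in hN *; set y := EnuN mu N cut in hN hc.
set p := probN mu N predT in hN h1; set j := EnuN mu N ind in hN hi.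
have /andP[hi1 hi2] : - e <= i - j <= e by rewrite -ler_norml.
have /andP[h11 h12] : - e <= 1 - p <= e by rewrite -ler_norml.
have -> : a - x = (a - b) + (b - y) - (x - y) by ring.
apply: (@le_trans _ _ (`|a - b| + `|b - y| + `|x - y|)).
  by apply: le_trans (ler_normB _ _) _; rewrite lerD2r ler_normD.
(* From i > 1 - e and the closeness of j to i and of p to 1 follow p - j <= 3 e and, as e <= 1, p <=
   2. The total is e + M e + e + 2 e + 3 M e. *)
have P1 : M * (1 - i) <= M * e by rewrite ler_wpM2l//; lra.
have P2 : M * (p - j) <= M * (3 * e) by rewrite ler_wpM2l//; lra.
have P3 : e * p <= e * 2 by rewrite ler_wpM2l//; lra.
apply: (@le_trans _ _ ((e + M * e) + e + (e * 2 + M * (3 * e)))); last by lra.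
apply: lerD; last by apply: le_trans hN _; apply: lerD.
by apply: lerD => //; apply: le_trans hI _; rewrite lerD2l.
Unshelve. all: by end_near. Qed.

End Estimate.

Lemma EnuN_cvg : EnuN mu N f @[N --> \oo] --> \int[nu]_T f T.
Proof.
apply/cvgrPdist_le => d d0.
have c0 : 0 < 4 + 4 * M by have := M_ge0; lra.
pose e := Num.min 1 (d / (4 + 4 * M)).
have e0 : 0 < e by rewrite lt_min ltr01 divr_gt0.
have e1 : e <= 1 by rewrite ge_min lexx.
have ed : (4 + 4 * M) * e <= d.
  by rewrite mulrC -ler_pdivlMr// ge_min lexx orbT.
have [r [n Fe]] := good_level_ex e0.
apply: filterS (EnuN_near (ltW e0) e0 Fe e1) => N H.
exact: le_trans ed.
Qed.

End WeakLimit.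
End Convergence.

(** * Uniqueness *)

Section Uniqueness.
Variables (R : realType) (mu : R).
Hypothesis hmu : mu < 0.
Implicit Types (T V : tree) (r n : nat) (P : set tree).

Let level r P : set (treeB R) := [set T | P (truncT r T)].

Lemma codecell_level r n P :
  @codecell R r n `&` level r P = set0 \/
  P (tdecode n) /\ @codecell R r n `&` level r P = cell r (tdecode n).
Proof.
have [->|->] := @codecellE R r n; last by left; rewrite set0I.
have [Pn|nP] := pselect (P (tdecode n)); [right|left].
  by split=> //; apply/seteqP; split=> [T []//|T E]; split=> //; rewrite /level /= E.
by apply/seteqP; split=> // T [E]; rewrite /level /= E.
Qed.

Lemma level_codecells (m : probability (treeB R) R) r P :
  m (level r P) = (\sum_(n <oo) m (@codecell R r n `&` level r P))%E.
Proof.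
have mC n : measurable (@codecell R r n `&` level r P).
  by apply: measurableI; [exact: measurable_codecell|exact: measurable_level].
have E : level r P = \bigcup_n (@codecell R r n `&` level r P).
  by apply/seteqP; split=> [T PT|T [n _ []]//]; exists (tcode (truncT r T)).
rewrite [in LHS]E measure_semi_bigcup//; last first.
  by rewrite -E; exact: measurable_level.
apply/trivIsetP => i j _ _ /eqP ij; apply/seteqP; split=> // T [[Ti _] [Tj _]].
by apply: ij; rewrite -Ti -Tj.
Qed.

(** Summing the prescribed masses over trees of height r + 1 gives [m] the same total as [nu] on the
    trees reaching that height, namely 1. The ball around a lower tree lies in the complement, so it
    is null for [m] as it is for [nu]. *)
Lemma cell_determined (nu m : probability (treeB R) R) :
  (forall r V, tfin V -> nu (cell r V) = (tree_mass mu r V)%:E) ->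
  (forall r V, tfin V -> height V = r.+1 -> m (cell r V) = (tree_mass mu r V)%:E) ->
  forall r V, m (cell r V) = nu (cell r V).
Proof.
move=> nuE mE r V; pose P : set tree := [set W | height W = r.+1].
have [Vf|nV] := pselect (tfin V); last first.
  suff -> : cell r V = set0 by rewrite !measure0.
  by apply/seteqP; split=> // T E; apply: nV; rewrite -E; exact: tfin_truncT.
have [hV|hV] := pselect (height V = r.+1); first by rewrite nuE// mE.
have mnu : m (level r P) = nu (level r P).
  rewrite !level_codecells; apply: eq_eseriesr => n _.
  have [->|[Pn ->]] := codecell_level r n P; first by rewrite !measure0.
  by rewrite nuE ?mE//; exact: tdecode_fin.
have nuC : nu (level r (~` P)) = 0%E.
  rewrite level_codecells eseries0// => n _ _.
  have [->|[Pn ->]] := codecell_level r n (~` P); first by rewrite measure0.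
  rewrite nuE; last exact: tdecode_fin.
  by rewrite /tree_mass; case: eqP.
have mP : measurable (level r P) by exact: measurable_level.
have CE : level r (~` P) = ~` level r P by [].
have mC : m (level r (~` P)) = 0%E.
  by rewrite CE probability_setC// mnu -probability_setC.
have mcell : m (cell r V) = 0%E.
  apply/eqP; rewrite eq_le measure_ge0 andbT -mC; apply: le_measure.
  - by apply/mem_set; exact: measurable_cell.
  - by apply/mem_set; exact: measurable_level.
  - by move=> T E; rewrite /level /= E.
by rewrite mcell nuE// /tree_mass; case: eqP.
Qed.

End Uniqueness.

Unset Implicit Arguments.
Set Strict Implicit.

Theorem mainTheorem7 (R : realType) (mu : R) (hmu : mu < 0) :
  let k := expR (- mu) in
  let gc := k / (1 + k) ^+ 2 in
  let X := fun g : R => (1 - Num.sqrt (1 - 4 * g)) / 2 in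
  let formula := fun (r : nat) (T0 : tree) =>
    let K := card_Dr r T0 in
    (K%:R * k ^+ (r - 1) * gc ^+ (nedges T0 - K) * X gc ^+ (K - 1))%:E in
  exists nu : probability (treeB R) R,
    (* weak convergence nu_N^{(mu)} => nu^{(mu)} *)
    (forall f : treeB R -> R, tbounded f -> tcontinuous f ->
       (fun N : nat => (EnuN mu N f)%:E) @ \oo --> (\int[nu]_x (f x)%:E)%E)
    /\
    (* the ball formula *)
    (forall (T0 : tree) (r : nat), tfin T0 -> (1 <= r)%N -> height T0 = r ->
       nu (tball r T0) = formula r T0)
    /\
    (* the formula characterizes nu^{(mu)} among Borel probability measures *)
    (forall nu' : probability (treeB R) R,
       (forall (T0 : tree) (r : nat), tfin T0 -> (1 <= r)%N -> height T0 = r ->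
          nu' (tball r T0) = formula r T0) ->
       forall A : set (treeB R), measurable A -> nu' A = nu A).
Proof.
move=> k gc X formula; have [nu nuE] := tree_measure_ex hmu.
have ball_cell r T0 : tball r.+1 T0 = cell r T0.
  apply/seteqP; split=> T; rewrite /tball /cell /=.
    by move=> E; apply: treeP => v; rewrite -E.
  by move=> <-.
have formulaE r V : height V = r.+1 -> formula r.+1 V = (tree_mass mu r V)%:E.
  move=> hV; rewrite /formula /tree_mass hV eqxx subn1 /=.
  by rewrite /X /gc half_sqrt_gc.
exists nu; split; [|split].
- move=> f [M fM] fc.
  have -> : (\int[nu]_x (f x)%:E)%E = (\int[nu]_x f x)%:E.
    rewrite /Rintegral fineK//; apply: integrable_fin_num => //.
    by apply: tbounded_integrable; [exists M|exact: tcontinuous_measurable].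
  apply: cvg_EFin; first exact: nearW.
  exact: (EnuN_cvg hmu nuE fM fc).
- by move=> T0 [//|r] Tf _ hT; rewrite ball_cell formulaE// nuE.
- move=> nu' nu'E; apply: tree_measure_unique; apply: (cell_determined nuE) => r V Vf hV.
  by rewrite -ball_cell nu'E// formulaE.
Qed.
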